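(* Fix an integer $d \geq 1$. If $\Gamma \subset \mathbb{Z}^d$ is infinite, then for infinitely many positive integers $m$, there exist real coefficients $(a_n)_{n\in\Gamma}$ such that for every $p\in (2m, 2m+2)$, $$\left\| \sum_{n \in \Gamma} |a_n| e(n \cdot x) \right\|_{L^p([0,1]^d)} < \left\| \sum_{n \in \Gamma} a_n e(n \cdot x) \right\|_{L^p([0,1]^d)}.$$
   Context: Notation: $e(\theta) := e^{2\pi i \theta}$ for $\theta\in\mathbb{R}$; $\|f\|_{L^p([0,1]^d)} := \big(\int_{[0,1]^d}|f(x)|^p\,dx\big)^{1/p}$. *)

(* Defs.v *)
From HB Require Import structures.
From mathcomp Require Import all_boot all_order all_algebra.
From mathcomp Require Import all_classical all_reals all_analysis.
From mathcomp Require Import complex.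

Set Implicit Arguments.
Unset Strict Implicit.
Unset Printing Implicit Defensive.

Import Order.TTheory GRing.Theory Num.Theory.

Local Open Scope classical_set_scope.
Local Open Scope ring_scope.

Section lebesgue_measure_Rd.
Context {R : realType}.
Local Notation RT := (measurableTypeR R).

Definition pair_cons n (z : RT * n.-tuple RT) : n.+1.-tuple RT :=
  [tuple of z.1 :: z.2].

Lemma measurable_pair_cons n : measurable_fun [set: _] (@pair_cons n).
Proof. exact: measurable_cons. Qed.

HB.instance Definition _ n := isMeasurableFun.Build _ _ _ _ (@pair_cons n)
  (@measurable_pair_cons n).

Let uncons n (x : n.+1.-tuple RT) : RT * n.-tuple RT :=
  (tnth x ord0, [tuple of behead x]).

Let pair_consK n : cancel (@pair_cons n) (@uncons n).
Proof. by case=> x t; congr pair; apply: val_inj. Qed.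

Section step.
Variables (n : nat) (mu : {sigma_finite_measure set (n.-tuple RT) -> \bar R}).

(* The image of lambda \x mu under the identification R x R^n = R^(n+1). *)
Definition lebesgue_cons : set (n.+1.-tuple RT) -> \bar R :=
  pushforward (lebesgue_measure \x mu)%E (@pair_cons n).

Let lebesgue_cons0 : lebesgue_cons set0 = 0%E.
Proof. exact: measure0. Qed.

Let lebesgue_cons_ge0 A : (0 <= lebesgue_cons A)%E.
Proof. exact: measure_ge0. Qed.

Let lebesgue_cons_sigma_additive : semi_sigma_additive lebesgue_cons.
Proof. exact: measure_semi_sigma_additive. Qed.

HB.instance Definition _ := isMeasure.Build _ _ _ lebesgue_cons
  lebesgue_cons0 lebesgue_cons_ge0 lebesgue_cons_sigma_additive.

Let lebesgue_cons_sigma_finite : sigma_finite setT lebesgue_cons.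
Proof.
have /sigma_finiteP[F [TF ndF Foo]] := sigma_finiteT (@lebesgue_measure R).
have /sigma_finiteP[G [TG ndG Goo]] := sigma_finiteT mu.
exists (fun i => @uncons n @^-1` (F i `*` G i)).
  rewrite -preimage_bigcup (_ : \bigcup_i _ = setT) ?preimage_setT//.
  rewrite -subTset => -[x t] _.
  have : [set: RT] x by []. rewrite TF => -[i _ Fx].
  have : [set: n.-tuple RT] t by []. rewrite TG => -[j _ Gt].
  exists (maxn i j) => //; split.
  - by move: x Fx; exact/subsetPset/ndF/leq_maxl.
  - by move: t Gt; exact/subsetPset/ndG/leq_maxr.
move=> i; have [mF Fi] := Foo i; have [mG Gi] := Goo i; split.
  rewrite -[X in measurable X]setTI.
  apply: measurable_fun_pair => //; last exact: measurableX.
    exact: measurable_tnth.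
  exact: measurable_behead.
rewrite /lebesgue_cons /pushforward -comp_preimage.
rewrite (_ : _ \o _ = id) ?preimage_id; last by apply/funext; exact: pair_consK.
by rewrite product_measure1E// lte_mul_pinfty// ge0_fin_numE.
Qed.

HB.instance Definition _ := Measure_isSigmaFinite.Build _ _ _ lebesgue_cons
  lebesgue_cons_sigma_finite.

End step.

(* R^d is the type of d-tuples with its product sigma-algebra (the Borel sets);
   on it this is the d-fold product of the Lebesgue measure of R. *)
Fixpoint lebesgue_measureRd d :
    {sigma_finite_measure set (d.-tuple RT) -> \bar R} :=
  match d with
  | 0 => \d_([tuple] : 0.-tuple RT)
  | d'.+1 => lebesgue_cons (lebesgue_measureRd d')
  end.

End lebesgue_measure_Rd.
Arguments lebesgue_measureRd {R} d.

Section exponential_sums.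
Context {R : realType}.

Definition unit_cube d : set (d.-tuple (measurableTypeR R)) :=
  [set x | forall i, 0 <= tnth x i <= 1].
Arguments unit_cube d : clear implicits.

Definition Lp_cube d (p : R) (f : d.-tuple (measurableTypeR R) -> R[i]) :
    \bar R :=
  ((\int[lebesgue_measureRd d]_(x in unit_cube d) (Normc.normc (f x) `^ p)%:E)
    `^ p^-1)%E.

Definition e2pi (theta : R) : R[i] :=
  (cos (2 * pi * theta) +i* sin (2 * pi * theta))%C.

Definition dotZR d (n : 'rV[int]_d) (x : d.-tuple (measurableTypeR R)) : R :=
  \sum_(i < d) (n 0 i)%:~R * tnth x i.

(* [\sum_(n \in Gamma)] is the library's finitely supported sum: it adds the
   nonzero terms, and is meaningful when [a] has finite support in [Gamma]. *)
Definition expsum d (Gamma : set 'rV[int]_d) (a : 'rV[int]_d -> R)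
    (x : d.-tuple (measurableTypeR R)) : R[i] :=
  \sum_(n \in Gamma) (a n)%:C%C * e2pi (dotZR n x).

End exponential_sums.
Arguments unit_cube {R} d.

(* Main.v *)
(* The sign of the first negative binomial coefficient of (1 + z)^(p/2), seen
   through an affine relation between frequencies, makes a sign change increase
   the norm.

   Take a maximal affinely independent family b in Gamma. Adjoining any further
   n in Gamma produces a finite family whose affine integer relations are the
   multiples of a single primitive lam, and the entries of lam are unbounded as
   n varies, since b and lam determine n. Some entry lam_c is odd, and we may
   take lam_c < 0. Put u_i = p_i - p_c for i <> c; let P and Q be the sums of
   the positive and of the negative parts of these lam_i, so that P - Q = - lam_c
   is odd and positive, and m = P - 2. With G = sum_i e(u_i . x), compare 1 + r G
   and -1 + r G for a small r > 0.

   For s = p/2 in (m, m+1) and c_j = binom(s, j), |1 + z|^(2s) is the limit of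
   |sum_(j <= N) c_j z^j|^2. Integrating, the two norms to the power p differ by
     - 2 sum_(j + l odd) c_j c_l r^(j+l) #{(f, g) | u_f = u_g},
   where f and g run over the words of lengths j and l in the u_i, with sums u_f
   and u_g. When u_f = u_g and j - l is odd, the letter counts of f and g differ
   by an odd, hence nonzero, multiple of lam, so j >= P and l >= Q or conversely.
   The terms (P, Q) and (Q, P) are positive because c_P < 0 < c_Q, and
   |c_(P+i)| <= (m+1)^i |c_P| makes them dominate all the others, for a radius r
   that does not depend on s. *)

Require Import Defs.
From mathcomp Require Import all_boot all_order all_algebra.
From mathcomp Require Import all_classical all_reals all_analysis.
From mathcomp Require Import measurable_realfun.
From mathcomp Require Import complex.
From mathcomp Require Import zify ring lra.
Set Implicit Arguments.
Unset Strict Implicit.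
Unset Printing Implicit Defensive.

Import Order.TTheory GRing.Theory Num.Theory numFieldNormedType.Exports.
Import Normc.
Local Open Scope classical_set_scope.
Local Open Scope ring_scope.

(** * Affine relations between lattice points *)

Definition affine_relation k d (p : 'I_k -> 'rV[int]_d) (mu : 'I_k -> int) :=
  \sum_i mu i = 0 /\ \sum_i mu i *: p i = 0.

Definition affinely_free k d (p : 'I_k -> 'rV[int]_d) :=
  forall mu, affine_relation p mu -> forall i, mu i = 0.

(** The rows [(1, p i)] live in dimension d + 1. More rows than that have a nontrivial rational
    dependency, which becomes an integer affine relation once multiplied by the product [D] of the
    denominators. *)
Lemma affinely_free_leq k d (p : 'I_k -> 'rV[int]_d) :
  affinely_free p -> (k <= d.+1)%N.
Proof.
move=> fp; rewrite leqNgt; apply/negP => dk.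
pose A : 'M[rat]_(k, 1 + d) :=
  row_mx (const_mx 1) (\matrix_(i, j) (p i 0 j)%:~R).
have : kermx A != 0.
  rewrite kermx_eq0 /row_free neq_ltn.
  by rewrite (leq_ltn_trans (rank_leq_col _)).
case/rowV0Pn => v /sub_kermxP vA0 v0.
move: vA0; rewrite mul_mx_row -row_mx0 => /eq_row_mx[v1 v2].
pose mu i := numq (v 0 i) * \prod_(j | j != i) denq (v 0 j).
pose D : int := \prod_j denq (v 0 j).
have muE i : (mu i)%:~R = D%:~R * v 0 i :> rat.
  by rewrite /mu /D [X in _ = X%:~R * _](bigD1 i)//= !rmorphM/= numqE; ring.
have D0 : D != 0 by apply/prodf_neq0 => i _; rewrite denq_neq0.
have : affine_relation p mu.
  split.
    apply/eqP; rewrite -(intr_eq0 rat) rmorph_sum/=.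
    under eq_bigr do rewrite muE.
    suff e : \sum_j v 0 j = 0 by rewrite -mulr_sumr e mulr0.
    move/matrixP: v1 => /(_ 0 0); rewrite !mxE => {2}<-.
    by apply: eq_bigr => j _; rewrite mxE mulr1.
  apply/rowP => j; rewrite summxE mxE.
  apply/eqP; rewrite -(intr_eq0 rat) rmorph_sum/=.
  under eq_bigr do rewrite mxE intrM muE -mulrA.
  suff e : \sum_i v 0 i * (p i 0 j)%:~R = 0 by rewrite -mulr_sumr e mulr0.
  move/matrixP: v2 => /(_ 0 j); rewrite !mxE => {2}<-.
  by apply: eq_bigr => i _; rewrite mxE.
move=> /fp mu0; case/eqP: v0; apply/rowP => l; rewrite mxE.
have /eqP := muE l; rewrite mu0 eq_sym mulf_eq0 intr_eq0 (negbTE D0)/=.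
by move/eqP.
Qed.

Definition cons_point k d (n : 'rV[int]_d) (b : 'I_k -> 'rV[int]_d)
  (i : 'I_k.+1) := if unlift ord0 i is Some j then b j else n.

Lemma affine_relation_subM k d (p : 'I_k -> 'rV[int]_d) mu nu t :
  affine_relation p mu -> affine_relation p nu ->
  affine_relation p (fun i => nu i - t * mu i).
Proof.
move=> [m1 m2] [n1 n2]; split.
  by rewrite sumrB -mulr_sumr m1 n1 mulr0 subr0.
under eq_bigr do rewrite scalerBl -scalerA.
by rewrite sumrB -scaler_sumr m2 n2 scaler0 subr0.
Qed.

Lemma cons_relation0 k d (n : 'rV[int]_d) (b : 'I_k -> 'rV[int]_d) mu :
  affinely_free b -> affine_relation (cons_point n b) mu -> mu ord0 = 0 ->
  forall i, mu i = 0.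
Proof.
move=> fb [m1 m2] mu0 i; case: (unliftP ord0 i) => [j ->|->//].
apply: (fb (fun j => mu (lift ord0 j))); split.
  by move: m1; rewrite big_ord_recl mu0 add0r.
move: m2; rewrite big_ord_recl mu0 scale0r add0r => {2}<-.
by apply: eq_bigr => l _; rewrite /cons_point liftK.
Qed.

(** Among the relations with a positive coefficient at [n], [lam] has the least one. Euclidean
    division by it leaves a relation whose coefficient at [n] is zero by minimality; that relation
    lives on the free family [b], so it vanishes. *)
Lemma cons_relation_generator k d (n : 'rV[int]_d) (b : 'I_k -> 'rV[int]_d) :
  affinely_free b -> ~ affinely_free (cons_point n b) ->
  exists lam, [/\ affine_relation (cons_point n b) lam, 0 < lam ord0 &
    forall mu, affine_relation (cons_point n b) mu ->
      exists t, forall i, mu i = t * lam i].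
Proof.
move=> fb nf.
pose G (g : nat) :=
  `[< (0 < g)%N /\ exists2 mu, affine_relation (cons_point n b) mu &
      mu ord0 = g%:Z >].
have exG : exists g, G g.
  move: nf => /existsNP[mu] /not_implyP[rmu /existsNP[i mui]].
  have mu0 : mu ord0 != 0.
    by apply/eqP => /(cons_relation0 fb rmu) /(_ i).
  exists `|mu ord0|%N; apply/asboolP; split; first by rewrite absz_gt0.
  case: (lerP 0 (mu ord0)) => h.
    by exists mu => //; rewrite gez0_abs.
  exists (fun i => - mu i); last by rewrite ltz0_abs.
  case: rmu => r1 r2; split; first by rewrite sumrN r1 oppr0.
  under eq_bigr do rewrite scaleNr.
  by rewrite sumrN r2 oppr0.
case: (ex_minnP exG) => g /asboolP[g0 [lam rlam lam0]] ming.
exists lam; split => //; first by rewrite lam0 ltz_nat.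
move=> mu rmu; exists (mu ord0 %/ g%:Z)%Z => i.
apply/eqP; rewrite -subr_eq0; apply/eqP.
have rr := affine_relation_subM (mu ord0 %/ g%:Z)%Z rlam rmu.
move: i; apply: (cons_relation0 fb rr).
have e : mu ord0 - (mu ord0 %/ g%:Z)%Z * lam ord0 = (mu ord0 %% g%:Z)%Z.
  by rewrite lam0 {1}(divz_eq (mu ord0) g) addrC addKr.
rewrite e; have g0' : g%:Z != 0 by lia.
have := modz_ge0 (mu ord0) g0'; have := ltz_pmod (mu ord0) (d := g) g0.
case E : (mu ord0 %% g)%Z => [h|//] hg _; case: (posnP h) => [->//|h0].
have : G h by apply/asboolP; split=> //; eexists; [exact: rr|exact: etrans e E].
by move/ming; move: hg; lia.
Qed.

Lemma infinite_unbounded_circuit d (Gamma : set 'rV[int]_d) (M : nat) :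
  infinite_set Gamma ->
  exists k (p : 'I_k.+1 -> 'rV[int]_d) (lam : 'I_k.+1 -> int),
    [/\ injective p, forall i, Gamma (p i), affine_relation p lam,
        forall mu, affine_relation p mu -> exists t, forall i, mu i = t * lam i &
        exists i, (M < `|lam i|)%N].
Proof.
move=> infG.
pose F k := `[< exists2 b : 'I_k -> 'rV[int]_d,
                  forall i, Gamma (b i) & affinely_free b >].
have exF : exists k, F k.
  exists 0%N; apply/asboolP; exists (fun _ => 0); first by case.
  by move=> mu _; case.
have ubF k : F k -> (k <= d.+1)%N.
  by move/asboolP => [b _ /affinely_free_leq].
case: (ex_maxnP exF ubF) => k /asboolP[b bG fb] maxk {exF ubF}.
have gen n : Gamma n -> exists lam,
  [/\ affine_relation (cons_point n b) lam, 0 < lam ord0 &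
    forall mu, affine_relation (cons_point n b) mu ->
      exists t, forall i, mu i = t * lam i].
  move=> Gn; apply: cons_relation_generator => // fn.
  suff /maxk : F k.+1 by rewrite ltnn.
  apply/asboolP; exists (cons_point n b) => // i.
  by rewrite /cons_point; case: unlift.
(* The threshold is [M.+1] rather than [M], so that the large entry is at least 2; the injectivity
   argument relies on this. *)
have [[n [Gn [lam [rl l0 gl] [i li]]]]|nex] := pselect (exists n, Gamma n /\
  exists2 lam, [/\ affine_relation (cons_point n b) lam, 0 < lam ord0 &
    forall mu, affine_relation (cons_point n b) mu ->
      exists t, forall i, mu i = t * lam i] & exists i, (M.+1 < `|lam i|)%N).
  exists k, (cons_point n b), lam; split => //.
  - move=> i1 i2 e12; apply/eqP/negPn/negP => i12.
    (* If two points coincided, this difference of indicators would be a nonzero multiple of [lam]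
       with all entries at most 1 in absolute value. *)
    pose mu l : int := (l == i1)%:R - (l == i2)%:R.
    have rmu : affine_relation (cons_point n b) mu.
      split.
        under eq_bigr do rewrite /mu !mulrb.
        by rewrite sumrB -!big_mkcond/= !big_pred1_eq subrr.
      under eq_bigr do rewrite /mu scalerBl !scaler_nat !mulrb.
      by rewrite sumrB -!big_mkcond/= !big_pred1_eq e12 subrr.
    have [t tE] := gl _ rmu.
    have t0 : t != 0.
      apply/eqP => t0; have := tE i1.
      by rewrite t0 mul0r /mu eqxx (negbTE i12).
    have : (`|lam i| <= `|mu i|)%N by rewrite tE abszM leq_pmull// absz_gt0.
    have : (`|mu i| <= 1)%N by rewrite /mu; case: eqP; case: eqP.
    by lia.
  - by move=> j; rewrite /cons_point; case: unlift.
  - by exists i; lia.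
case: infG.
(* With all entries bounded by [M.+1], only finitely many [lam] are available, stored in [T] after a
   shift by [M.+1]. The map [h] solves the relation for [n] by an exact division, so [Gamma] would
   be finite. *)
pose T := {ffun 'I_k.+1 -> 'I_(M.+1.*2.+1)}.
pose val (t : T) i : int := (t i)%:Z - M.+1%:Z.
pose h (t : T) : 'rV[int]_d := \row_j
  ((- \sum_(i < k) val t (lift ord0 i) * b i 0 j) %/ val t ord0)%Z.
apply: (@sub_finite_set _ _ (h @` setT)); last first.
  by apply: finite_image; exact: finite_finset.
move=> n Gn; have [lam [[rl1 rl2] l0 gl]] := gen n Gn.
have bl i : (`|lam i| <= M.+1)%N.
  rewrite leqNgt; apply/negP => Ml; apply: nex; exists n; split => //.
  by exists lam => //; exists i.
exists [ffun i => inord `|(lam i + M.+1%:Z)%R|%N] => //.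
have valE i : val [ffun i => inord `|(lam i + M.+1%:Z)%R|%N] i = lam i.
  rewrite /val ffunE inordK; first by have := bl i; lia.
  by have := bl i; rewrite -addnn; lia.
apply/rowP => j; rewrite mxE valE.
under eq_bigr do rewrite valE.
move/rowP: rl2 => /(_ j); rewrite big_ord_recl !mxE summxE.
rewrite /cons_point unlift_none => /eqP; rewrite addr_eq0 => /eqP e.
suff -> : - (\sum_(i < k) lam (lift ord0 i) * b i 0 j) = lam ord0 * n 0 j.
  by rewrite mulKz// gt_eqF.
rewrite e; congr (- _); apply: eq_bigr => i _.
by rewrite mxE liftK.
Qed.

(** * The binomial expansion *)

(** The generalised binomial coefficient s(s - 1)...(s - j + 1) / j!. *)
Fixpoint gbinom (R : fieldType) (s : R) (j : nat) : R :=
  if j is j'.+1 then gbinom s j' * (s - j'%:R) / j'.+1%:R else 1.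

Lemma gbinomS (R : fieldType) (s : R) j :
  gbinom s j.+1 = gbinom s j * (s - j%:R) / j.+1%:R.
Proof. by []. Qed.

Section gbinom.
Variables (R : realType) (s : R) (m : nat).
Hypotheses (ms : m%:R < s) (sm : s < m.+1%:R).

Lemma gbinom_gt0 j : (j <= m.+1)%N -> 0 < gbinom s j.
Proof.
elim: j => //= j ih jm; rewrite divr_gt0// ?ltr0n// mulr_gt0 ?ih ?(ltnW jm)//.
by rewrite subr_gt0 (le_lt_trans _ ms)// ler_nat -ltnS.
Qed.

(** The last factor s - (m + 1) is the first negative one. *)
Lemma gbinom_lt0 : gbinom s m.+2 < 0.
Proof.
rewrite gbinomS pmulr_llt0 ?invr_gt0 ?ltr0n//.
by rewrite pmulr_rlt0 ?subr_lt0// gbinom_gt0.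
Qed.

(** Both s and j lie between 0 and (m + 1)(j + 1), so |s - j| is at most that product. *)
Lemma normr_gbinomS j : `|gbinom s j.+1| <= m.+1%:R * `|gbinom s j|.
Proof.
rewrite gbinomS normrM normfV normrM [leRHS]mulrC [`|j.+1%:R|]ger0_norm// -mulrA.
rewrite ler_wpM2l// ler_pdivrMr ?ltr0n// -natrM ler_norml.
have : (0 : R) < s by rewrite (le_lt_trans _ ms).
move: sm; rewrite natrM -[m.+1%:R]natr1 -[j.+1%:R]natr1.
have : (0 : R) <= m%:R by []. have : (0 : R) <= j%:R by [].
by move=> j0 m0 sm' s0; apply/andP; split; nra.
Qed.

Lemma normr_gbinomD i j : `|gbinom s (i + j)| <= m.+1%:R ^+ i * `|gbinom s j|.
Proof.
elim: i => [|i ih]; first by rewrite mul1r.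
by rewrite addSn (le_trans (normr_gbinomS _))// exprS -mulrA ler_wpM2l.
Qed.

Lemma normr_gbinom i : `|gbinom s i| <= m.+1%:R ^+ i.
Proof. by have := normr_gbinomD i 0; rewrite addn0 normr1 mulr1. Qed.

End gbinom.

Section normc.
Variable R : rcfType.
Implicit Type z : R[i].

Lemma normcX z n : normc (z ^+ n) = normc z ^+ n.
Proof. by elim: n => [|n ih]; rewrite ?normc1// !exprS normcM ih. Qed.

Lemma normc_ge0 z : 0 <= normc z.
Proof. by case: z => a b; exact: sqrtr_ge0. Qed.

Lemma normr_Re_le z : `|complex.Re z| <= normc z.
Proof.
by case: z => a b /=; rewrite -sqrtr_sqr ler_wsqrtr// lerDl sqr_ge0.
Qed.

Lemma normr_Im_le z : `|complex.Im z| <= normc z.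
Proof.
by case: z => a b /=; rewrite -sqrtr_sqr ler_wsqrtr// lerDr sqr_ge0.
Qed.

Lemma sqr_normcE z : normc z ^+ 2 = complex.Re z ^+ 2 + complex.Im z ^+ 2.
Proof. by case: z => a b /=; rewrite sqr_sqrtr// addr_ge0 ?sqr_ge0. Qed.

End normc.

Lemma geometric_sum_le (R : realFieldType) (y : R) n :
  0 <= y < 1 -> \sum_(j < n) y ^+ j <= (1 - y)^-1.
Proof.
case/andP => y0 y1; have y1' : 0 < 1 - y by rewrite subr_gt0.
rewrite -(ler_pM2l y1') divff ?gt_eqF// -[in leLHS]opprB mulNr -subrX1 opprB.
by rewrite lerBlDr lerDl exprn_ge0.
Qed.

Definition binomial_sum (R : realType) (s : R) (N : nat) (z : R[i]) : R[i] :=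
  \sum_(j < N.+1) (gbinom s j)%:C%C * z ^+ j.

Section binomial_sum.
Variables (R : realType) (s : R) (m : nat).
Hypotheses (ms : m%:R < s) (sm : s < m.+1%:R).
Variables (z : R[i]).
Hypothesis zm : m.+1%:R * normc z <= 4^-1.

(** [P] and [Q] are the real and imaginary parts of the truncated series at t z, as polynomials in a
    real t, and [D] is |1 + t z|^2. Moving along the segment from 0 to z avoids complex powers. *)
Let P N : {poly R} := \sum_(j < N.+1) (gbinom s j * complex.Re (z ^+ j)) *: 'X^j.
Let Q N : {poly R} := \sum_(j < N.+1) (gbinom s j * complex.Im (z ^+ j)) *: 'X^j.
Let a := complex.Re z.
Let b := complex.Im z.
Let D : {poly R} := (1 + a *: 'X) ^+ 2 + (b *: 'X) ^+ 2.

(** [E1] and [E2] are the real and imaginary parts of the defect (1 + z t) w' - s z w, where w = P +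
    i Q. *)
Let E1 N t := (1 + a * t) * (P N)^`().[t] - b * t * (Q N)^`().[t]
  - s * (a * (P N).[t] - b * (Q N).[t]).
Let E2 N t := (1 + a * t) * (Q N)^`().[t] + b * t * (P N)^`().[t]
  - s * (a * (Q N).[t] + b * (P N).[t]).

Let exprS_Re N : complex.Re (z ^+ N.+1) =
  a * complex.Re (z ^+ N) - b * complex.Im (z ^+ N).
Proof. by rewrite exprS /a /b; case: z => ? ?; case: (_ ^+ N). Qed.

Let exprS_Im N : complex.Im (z ^+ N.+1) =
  a * complex.Im (z ^+ N) + b * complex.Re (z ^+ N).
Proof. by rewrite exprS /a /b; case: z => ? ?; case: (_ ^+ N). Qed.

Let gbinomM N : gbinom s N.+1 * N.+1%:R = gbinom s N * (s - N%:R).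
Proof. by rewrite gbinomS mulfVK// pnatr_eq0. Qed.

(* The truncated series solves [(1 + z t) w' = s z w] up to its last term. *)
Let remainder N t :
  E1 N t = - (gbinom s N.+1 * N.+1%:R) * complex.Re (z ^+ N.+1) * t ^+ N /\
  E2 N t = - (gbinom s N.+1 * N.+1%:R) * complex.Im (z ^+ N.+1) * t ^+ N.
Proof.
have PS M : (P M.+1).[t] =
    (P M).[t] + gbinom s M.+1 * complex.Re (z ^+ M.+1) * t ^+ M.+1.
  by rewrite /P big_ord_recr/= !hornerE.
have QS M : (Q M.+1).[t] =
    (Q M).[t] + gbinom s M.+1 * complex.Im (z ^+ M.+1) * t ^+ M.+1.
  by rewrite /Q big_ord_recr/= !hornerE.
have P'S M : (P M.+1)^`().[t] = (P M)^`().[t] +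
    gbinom s M.+1 * complex.Re (z ^+ M.+1) * (M.+1%:R * t ^+ M).
  by rewrite /P big_ord_recr/= derivD derivZ derivXn hornerD hornerZ hornerMn
    hornerXn mulr_natl.
have Q'S M : (Q M.+1)^`().[t] = (Q M)^`().[t] +
    gbinom s M.+1 * complex.Im (z ^+ M.+1) * (M.+1%:R * t ^+ M).
  by rewrite /Q big_ord_recr/= derivD derivZ derivXn hornerD hornerZ hornerMn
    hornerXn mulr_natl.
elim: N => [|N [ih1 ih2]].
  rewrite /E1 /E2 /P /Q !big_ord_recl !big_ord0 /= !addr0 !derivZ !derivXn.
  by rewrite !expr0 !mulr0n !hornerE /= -/a -/b; split; field.
rewrite gbinomM (exprS_Re N.+1) (exprS_Im N.+1).
have r1 : E1 N.+1 t - E1 N t =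
  (1 + a * t) * (gbinom s N.+1 * complex.Re (z ^+ N.+1) * (N.+1%:R * t ^+ N))
  - b * t * (gbinom s N.+1 * complex.Im (z ^+ N.+1) * (N.+1%:R * t ^+ N))
  - s * (a * (gbinom s N.+1 * complex.Re (z ^+ N.+1) * t ^+ N.+1)
       - b * (gbinom s N.+1 * complex.Im (z ^+ N.+1) * t ^+ N.+1)).
  by rewrite /E1 PS QS P'S Q'S; ring.
have r2 : E2 N.+1 t - E2 N t =
  (1 + a * t) * (gbinom s N.+1 * complex.Im (z ^+ N.+1) * (N.+1%:R * t ^+ N))
  + b * t * (gbinom s N.+1 * complex.Re (z ^+ N.+1) * (N.+1%:R * t ^+ N))
  - s * (a * (gbinom s N.+1 * complex.Im (z ^+ N.+1) * t ^+ N.+1)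
       + b * (gbinom s N.+1 * complex.Re (z ^+ N.+1) * t ^+ N.+1)).
  by rewrite /E2 PS QS P'S Q'S; ring.
split.
  rewrite -[LHS](subrK (E1 N t)) r1 ih1.
  move: (gbinom s N.+1) (complex.Re (z ^+ N.+1)) (complex.Im (z ^+ N.+1)) => c x y.
  rewrite exprS. ring.
rewrite -[LHS](subrK (E2 N t)) r2 ih2.
move: (gbinom s N.+1) (complex.Re (z ^+ N.+1)) (complex.Im (z ^+ N.+1)) => c x y.
rewrite exprS; ring.
Qed.

Let normcz : normc z <= 4^-1.
Proof.
by rewrite (le_trans _ zm)// ler_peMl ?normc_ge0// ler1n.
Qed.

Let coef_le j (x : R) : `|x| <= normc (z ^+ j) -> `|gbinom s j * x| <= 4^-1 ^+ j.
Proof.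
move=> xz; rewrite normrM (le_trans (ler_pM _ _ (normr_gbinom ms sm j) xz))//.
by rewrite normcX -exprMn lerXn2r// ?nnegrE ?mulr_ge0 ?normc_ge0.
Qed.

Let sum_le N (t : R) (x : nat -> R) : 0 <= t <= 1 ->
  (forall j, `|x j| <= normc (z ^+ j)) ->
  `|(\sum_(j < N) (gbinom s j * x j) *: 'X^j).[t]| <= 2.
Proof.
case/andP=> t0 t1 xz; rewrite horner_sum (le_trans (ler_norm_sum _ _ _))//.
have h : \sum_(j < N) 4^-1 ^+ j <= 2 :> R.
  by rewrite (le_trans (geometric_sum_le _ _))//;
    [lra|rewrite -[leRHS]invrK lef_pV2 ?posrE; lra].
rewrite (le_trans _ h)// ler_sum// => j _.
rewrite hornerZ hornerXn normrM (le_trans (ler_piMr _ _)) ?coef_le//.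
by rewrite ger0_norm ?exprn_ge0// exprn_ile1.
Qed.

Let P_le N (t : R) : 0 <= t <= 1 -> `|(P N).[t]| <= 2.
Proof.
move=> t01; apply: (@sum_le N.+1 _ (fun j => complex.Re (z ^+ j)) t01) => j.
exact: normr_Re_le.
Qed.

Let Q_le N (t : R) : 0 <= t <= 1 -> `|(Q N).[t]| <= 2.
Proof.
move=> t01; apply: (@sum_le N.+1 _ (fun j => complex.Im (z ^+ j)) t01) => j.
exact: normr_Im_le.
Qed.

Let remainder_le N (t : R) (x : R) : 0 <= t <= 1 -> `|x| <= normc (z ^+ N.+1) ->
  `|- (gbinom s N.+1 * N.+1%:R) * x * t ^+ N| <= 2^-1 ^+ N.
Proof.
case/andP=> t0 t1 xz; rewrite mulNr mulrAC mulNr normrN normrM.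
rewrite (le_trans (ler_piMr _ _))//.
  by rewrite ger0_norm ?exprn_ge0// exprn_ile1.
rewrite normrM [X in _ * X]ger0_norm//.
rewrite (le_trans (ler_wpM2r _ (coef_le xz)))//.
(* One factor 2^-(N+1) absorbs N + 1; the other is at most 2^-N. *)
have -> : (4^-1 : R) = 2^-1 * 2^-1 by lra.
rewrite exprMn -mulrA (le_trans (ler_piMr _ _)) ?exprn_ge0//.
  rewrite exprVn mulrC ler_pdivrMr ?exprn_gt0// mul1r -natrX ler_nat.
  exact/ltnW/ltn_expl.
by rewrite ler_wiXn2l//; lra.
Qed.

Let D_ge (t : R) : 0 <= t <= 1 -> 4^-1 <= D.[t].
Proof.
case/andP => t0 t1.
have := normr_Re_le z; rewrite -/a => /le_trans/(_ normcz).
rewrite ler_norml => /andP[h1 h2].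
rewrite /D !hornerE.
have h : 3 / 4 <= 1 + a * t by nra.
by nra.
Qed.

Let D1E : D.[1] = normc (1 + z) ^+ 2.
Proof.
rewrite sqr_normcE /D !hornerE /a /b. by case: z => ? ? /=; rewrite add0r.
Qed.

Let D0E : D.[0] = 1.
Proof. by rewrite /D !hornerE expr0n addr0 expr1n. Qed.

Let H N : {poly R} := P N ^+ 2 + Q N ^+ 2.

Let H1E N : (H N).[1] = normc (binomial_sum s N z) ^+ 2.
Proof.
rewrite sqr_normcE /H !hornerE /P /Q !horner_sum /binomial_sum.
rewrite !raddf_sum /=; congr (_ ^+ 2 + _ ^+ 2); apply: eq_bigr => j _;
  rewrite hornerZ hornerXn expr1n mulr1; case: (z ^+ j) => x y /=; ring.
Qed.

Let H0E N : (H N).[0] = 1.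
Proof.
rewrite /H !hornerE /P /Q !horner_sum !big_ord_recl !big1 ?addr0; last 2 first.
- by move=> i _; rewrite hornerZ hornerXn expr0n mulr0.
- by move=> i _; rewrite hornerZ hornerXn expr0n mulr0.
by rewrite !hornerE /= expr1n expr0n addr0.
Qed.

(** Both sides are twice the real part of the conjugate of (1 + t z) w times the defect. Up to a
    power of [D], this is the derivative of |w|^2 / |1 + t z|^(2s). *)
Let derivHD N t : (H N)^`().[t] * D.[t] - s * (H N).[t] * D^`().[t] =
  2 * (((1 + a * t) * (P N).[t] - b * t * (Q N).[t]) * E1 N t +
       ((1 + a * t) * (Q N).[t] + b * t * (P N).[t]) * E2 N t).
Proof.
rewrite /H /D /E1 /E2 !poly.derivE !hornerE/=.
ring.
Qed.

Let derivHD_le N (t : R) : 0 <= t <= 1 ->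
  `|(H N)^`().[t] * D.[t] - s * (H N).[t] * D^`().[t]| <= 12 * 2^-1 ^+ N.
Proof.
move=> t01; have [e1 e2] := remainder N t; rewrite derivHD e1 e2.
have hx := remainder_le t01 (normr_Re_le (z ^+ N.+1)).
have hy := remainder_le t01 (normr_Im_le (z ^+ N.+1)).
have hp := P_le N t01; have hq := Q_le N t01.
have ct c : `|c| <= normc z -> `|c * t| <= 4^-1.
  move=> cz; rewrite normrM (le_trans (ler_piMr _ _))//.
    by case/andP: t01 => t0 t1; rewrite ger0_norm.
  exact: le_trans cz normcz.
have ha := ct _ (normr_Re_le z); have hb := ct _ (normr_Im_le z).
(* Here 3 = 5/4 * 2 + 1/4 * 2 bounds both coordinates of (1 + t z) w; the constant 12 is then 2 * (3
   + 3). *)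
have h3 (c d u v : R) : `|c| <= 5 / 4 -> `|d| <= 4^-1 -> `|u| <= 2 -> `|v| <= 2 ->
    `|c * u + d * v| <= 3.
  move=> hc hd hu hv; rewrite (le_trans (ler_normD _ _))// !normrM.
  have := ler_pM (normr_ge0 _) (normr_ge0 _) hc hu.
  have := ler_pM (normr_ge0 _) (normr_ge0 _) hd hv.
  by lra.
have h1a : `|1 + a * t| <= 5 / 4.
  by rewrite (le_trans (ler_normD _ _))// normr1; move: ha; rewrite -/a; lra.
have := h3 _ (- (b * t)) _ _ h1a _ hp hq; rewrite normrN mulNr => /(_ hb).
have := h3 _ _ _ _ h1a hb hq hp.
move: (_ + b * t * _) (_ - b * t * _) => u v hu hv.
rewrite normrM ger0_norm// (le_trans (ler_wpM2l _ (ler_normD _ _)))//.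
rewrite (normrM v) (normrM u).
have := ler_pM (normr_ge0 _) (normr_ge0 _) hv hx.
have := ler_pM (normr_ge0 _) (normr_ge0 _) hu hy.
by lra.
Qed.

(** This is |w|^2 / |1 + t z|^(2s), which the full series would make constantly 1. *)
Let phi N t := (H N).[t] * D.[t] `^ (- s).

Let is_derive_phi N (t : R) : 0 <= t <= 1 -> is_derive t 1 (phi N)
  (((H N)^`().[t] * D.[t] - s * (H N).[t] * D^`().[t]) * D.[t] `^ (- (s + 1))).
Proof.
move=> t01; have D0 : 0 < D.[t] by rewrite (lt_le_trans _ (D_ge t01)).
have dD : is_derive t 1 ((fun x => x `^ (- s)) \o horner D)
    (- s * D.[t] `^ (- s - 1) * D^`().[t]).
  by apply: is_derive1_comp; exact: (is_derive1_powR (- s) D0).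
apply: is_derive_eq; rewrite /GRing.scale/=.
have -> : D.[t] `^ (- s) = D.[t] * D.[t] `^ (- (s + 1)).
  rewrite opprD -[X in X * _]powRr1 ?ltW// -powRD; last by rewrite (gt_eqF D0) implybT.
  by congr (_ `^ _); ring.
by rewrite opprD; ring.
Qed.

(** The quotient [phi N] is 1 at t = 0 and its derivative is O(2^-N) on [0, 1], so the mean value
    theorem controls it at t = 1. The factor 4^(s+1) bounds [D] to the power -(s + 1), since D >=
    1/4, and 4^s bounds |1 + z|^(2s). *)
Lemma binomial_sum_approx N :
  `|normc (binomial_sum s N z) ^+ 2 - normc (1 + z) `^ (2 * s)| <=
    12 * 4 `^ s * 4 `^ (s + 1) * 2^-1 ^+ N.
Proof.
have s0 : 0 <= s by rewrite ltW// (le_lt_trans _ ms).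
have D10 : 0 <= D.[1] by rewrite D1E exprn_ge0// normc_ge0.
rewrite powRrM powR_mulrn ?normc_ge0// -D1E -H1E.
have dphi (x : R) : x \in `[0, 1] -> derivable (phi N) x 1.
  by rewrite in_itv/= => x01; have := is_derive_phi N x01 => dp; exact: ex_derive.
have cphi : {within `[0, 1], continuous (phi N)}.
  exact: derivable_within_continuous.
pose df (x : R) :=
  ((H N)^`().[x] * D.[x] - s * (H N).[x] * D^`().[x]) * D.[x] `^ (- (s + 1)).
have dphi' (x : R) : x \in `]0, 1[ -> is_derive x 1 (phi N) (df x).
  by rewrite in_itv/= => /andP[/ltW x0 /ltW x1]; apply: is_derive_phi; rewrite x0.
have [c] := MVT_segment ler01 dphi' cphi.
rewrite in_itv/= => c01; rewrite /phi /df H0E D0E powR1 mulr1 subr0 mulr1 => e.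
have D1s : 0 < D.[1] `^ s.
  by rewrite powR_gt0// (lt_le_trans _ (D_ge _))// ler01 lexx.
have -> : (H N).[1] - D.[1] `^ s = D.[1] `^ s * ((H N).[1] * D.[1] `^ (- s) - 1).
  by rewrite powRN mulrBr mulr1 mulrCA divff ?mulr1// gt_eqF.
rewrite e 2!normrM (ger0_norm (powR_ge0 _ _)) (ger0_norm (powR_ge0 _ _)).
have hD : D.[1] `^ s <= 4 `^ s.
  rewrite ge0_ler_powR// ?nnegrE// D1E (_ : 4 = 2 ^+ 2); last by lra.
  rewrite lerXn2r ?nnegrE ?normc_ge0//.
  by rewrite (le_trans (le_normcD _ _))// normc1; move: normcz; lra.
have hDc : D.[c] `^ (- (s + 1)) <= 4 `^ (s + 1).
  have s1 : 0 <= s + 1 by rewrite addr_ge0.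
  have Dc := D_ge c01.
  have -> : 4 `^ (s + 1) = (4^-1 `^ (s + 1))^-1.
    by rewrite -powRN -powR_inv1// -powRrM mulN1r opprK.
  rewrite powRN lef_pV2 ?posrE ?powR_gt0 ?invr_gt0//; last first.
    by rewrite (lt_le_trans _ Dc)// invr_gt0.
  by rewrite ge0_ler_powR// ?nnegrE// (le_trans _ Dc).
have := ler_pM (powR_ge0 _ _) (mulr_ge0 (normr_ge0 _) (powR_ge0 _ _)) hD
  (ler_pM (normr_ge0 _) (powR_ge0 _ _) (derivHD_le N c01) hDc).
move/le_trans; apply.
by rewrite [leRHS](_ : _ = 4 `^ s * (12 * 2^-1 ^+ N * 4 `^ (s + 1)))//; ring.
Qed.

End binomial_sum.

(** * Integrals over the unit cube *)

Lemma measurable_unit_cube (R : realType) d : measurable (@unit_cube R d).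
Proof.
have -> : @unit_cube R d = \bigcap_(i in [set: 'I_d])
    ((fun x => tnth x i) @^-1` `[0, 1]).
  apply/seteqP; split => x /= h i; first by move=> _ /=; rewrite in_itv/=.
  by have := h i I; rewrite /= in_itv.
apply: fin_bigcap_measurable; first exact: finite_finset.
move=> i _; rewrite -[X in measurable X]setTI.
exact: measurable_tnth.
Qed.

Lemma measurable_dotZR (R : realType) d (v : 'rV[int]_d) :
  measurable_fun [set: d.-tuple (measurableTypeR R)] (dotZR v).
Proof.
rewrite /dotZR; apply: measurable_sum => i.
by apply: measurable_funM; [exact: measurable_cst|exact: measurable_tnth].
Qed.

(** The measure is the image of a product measure and the cube pulls back to [0, 1] times the
    smaller cube, so this is Tonelli for nonnegative functions. *)
Lemma integral_unit_cubeS (R : realType) d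
    (f : d.+1.-tuple (measurableTypeR R) -> \bar R) :
  measurable_fun setT f -> (forall x, 0 <= f x)%E ->
  (\int[lebesgue_measureRd d.+1]_(x in unit_cube d.+1) f x =
   \int[lebesgue_measure]_(x in `[0%R, 1%R])
     \int[lebesgue_measureRd d]_(t in unit_cube d) f (pair_cons (x, t)))%E.
Proof.
move=> mf f0.
rewrite [LHS]ge0_integral_pushforward//; last 2 first.
- exact: measurable_unit_cube.
- exact: measurable_funTS.
have cubeE : @pair_cons R d @^-1` unit_cube d.+1 = `[0, 1] `*` unit_cube d.
  apply/seteqP; split => -[x t] /=.
    move=> h; split => [|i].
      by have := h ord0; rewrite in_itv/= (tnth_nth 0).
    by have := h (lift ord0 i); rewrite !(tnth_nth 0).
  case; rewrite in_itv/= => hx ht i.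
  case: (unliftP ord0 i) => [j ->|->]; last by rewrite (tnth_nth 0).
  by have := ht j; rewrite !(tnth_nth 0).
rewrite cubeE integral_mkcond fubini_tonelli1; last 2 first.
- apply/(measurable_restrictT _ (measurableX _ _)) => //.
    exact: measurable_unit_cube.
  apply: measurable_funTS; apply: measurableT_comp => //.
- by move=> z; apply: erestrict_ge0 => y _; exact: f0.
rewrite [RHS]integral_mkcond; apply: eq_integral => x _.
rewrite /fubini_F patchE; case: ifPn => xI; last first.
  apply: integral0_eq => t _; rewrite patchE ifF//; apply/negbTE.
  by move: xI; apply: contra; rewrite !inE => -[].
rewrite [RHS]integral_mkcond; apply: eq_integral => t _.
rewrite !patchE/=; congr (if _ then _ else _).
move: xI; rewrite inE => xI.
by apply/idP/idP; rewrite !inE => // -[].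
Qed.

Lemma sinD_int2pi (R : realType) (a : R) (n : int) :
  sin (a + n%:~R * (pi *+ 2)) = sin a.
Proof.
case: n => n; first by rewrite -pmulrn mulr_natl (periodicn (@sinD2pi R)).
rewrite -[in RHS](subrK (pi *+ 2 *+ n.+1) a) (periodicn (@sinD2pi R)).
by rewrite NegzE mulrNz -pmulrn mulNr mulr_natl.
Qed.

Lemma is_derive_continuous (R : realType) (f : R -> R) (x df : R) :
  is_derive x 1 f df -> {for x, continuous f}.
Proof.
by move=> fx; apply/differentiable_continuous/derivable1_diffP; exact: ex_derive.
Qed.

Lemma integral_cos (R : realType) (th : R) (n : int) :
  (\int[lebesgue_measure]_(x in `[0%R, 1%R]) (1 + cos (2 * pi * (th + n%:~R * x)))%:E =
    (1 + (n == 0)%:R * cos (2 * pi * th))%:E)%E.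
Proof.
have [->|n0] := eqVneq n 0.
  under eq_integral do rewrite mul0r addr0.
  by rewrite mul1r integral_cst//= lebesgue_measure_itv/= lte_fin ltr01 sube0 mule1.
rewrite mul0r addr0.
have A0 : 2 * pi * n%:~R != 0 :> R.
  by rewrite !mulf_neq0 ?intr_eq0// gt_eqF// pi_gt0.
pose F (x : R) : R := x + (2 * pi * n%:~R)^-1 * sin (2 * pi * (th + n%:~R * x)).
have dF (x : R) : is_derive x 1 F (1 + cos (2 * pi * (th + n%:~R * x))).
  apply: is_derive_eq; rewrite /GRing.scale/= add0r mul1r mulr1.
  by rewrite [cos _ * _]mulrC mulKf.
have cF x := is_derive_continuous (dF x).
rewrite (@continuous_FTC2 _ _ F)//.
- rewrite /F -EFinB mulr1 mulr0 addr0 [_ * (th + _)]mulrDr.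
  have -> : 2 * pi * n%:~R = n%:~R * (pi *+ 2) :> R by rewrite -mulr_natl; ring.
  by rewrite sinD_int2pi; congr EFin; ring.
- apply: continuous_subspaceT => x.
  by apply: (@is_derive_continuous _ _ _ _); apply: is_derive_eq.
- split.
  + by move=> x _; exact: ex_derive.
  + exact/cvg_at_right_filter/cF.
  + exact/cvg_at_left_filter/cF.
- by move=> x _; rewrite derive1E; apply: derive_val.
Qed.

Lemma measurable_cos_dotZR (R : realType) d (th : R) (v : 'rV[int]_d) :
  measurable_fun [set: d.-tuple (measurableTypeR R)]
    (fun x => cos (2 * pi * (th + dotZR v x))).
Proof.
apply: measurableT_comp.
  by apply: continuous_measurable_fun; exact: continuous_cos.
apply: measurable_funM; first exact: measurable_cst.
by apply: measurable_funD; [exact: measurable_cst|exact: measurable_dotZR].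
Qed.

(** Induction on d through Tonelli: the added 1 keeps the integrand nonnegative, and the phase [th]
    absorbs the coordinate that is held fixed. *)
Lemma integral_unit_cube_cos (R : realType) d (th : R) (v : 'rV[int]_d) :
  (\int[lebesgue_measureRd d]_(x in unit_cube d)
     (1 + cos (2 * pi * (th + dotZR v x)))%:E =
    (1 + (v == 0)%:R * cos (2 * pi * th))%:E)%E.
Proof.
elim: d th v => [|d ih] th v.
  rewrite [v]thinmx0 eqxx mul1r/= integral_dirac//; last 2 first.
  - exact: measurable_unit_cube.
  - apply/measurable_funTS/measurable_EFinP/measurable_funD => //.
    exact: measurable_cos_dotZR.
  rewrite diracE mem_set /=; last by case.
  by rewrite mul1e /dotZR big_ord0 addr0.
rewrite integral_unit_cubeS; last 2 first.
- apply/measurable_EFinP/measurable_funD => //.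
  exact: measurable_cos_dotZR.
- by move=> x; rewrite lee_fin -lerBlDl sub0r cos_geN1.
pose v' : 'rV_d := \row_j v 0 (lift ord0 j).
have step (x : R) : (\int[lebesgue_measureRd d]_(t in unit_cube d)
    (1 + cos (2 * pi * (th + dotZR v (pair_cons (x, t)))))%:E =
    (1 + (v' == 0)%:R * cos (2 * pi * (th + (v 0 ord0)%:~R * x)))%:E)%E.
  rewrite -ih; apply: eq_integral => t _.
  rewrite /dotZR big_ord_recl/= (tnth_nth 0)/= addrA.
  congr (1 + cos (_ * (_ + _)))%:E; apply: eq_bigr => i _.
  by rewrite mxE !(tnth_nth 0).
under eq_integral do rewrite step.
have -> : (v == 0) = (v 0 ord0 == 0) && (v' == 0).
  apply/eqP/andP => [e|[/eqP v0 /eqP /rowP v'0]].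
    by rewrite e mxE eqxx; split => //; apply/eqP/rowP => j; rewrite /v' e !mxE.
  apply/rowP => j; rewrite mxE; case: (unliftP ord0 j) => [l ->|->//].
  by have := v'0 l; rewrite !mxE.
case: (v' == 0) => /=.
  by rewrite andbT; under eq_integral do rewrite mul1r; exact: integral_cos.
rewrite andbF mul0r addr0; under eq_integral do rewrite mul0r addr0.
by rewrite integral_cst//= lebesgue_measure_itv/= lte_fin ltr01 sube0 mule1.
Qed.

(** At frequency 0 and phase 1/4 the cosine vanishes and the previous integrand is the constant
    1. *)
Lemma lebesgue_unit_cube (R : realType) d :
  lebesgue_measureRd d (@unit_cube R d) = 1%E.
Proof.
have := integral_unit_cube_cos (4^-1 : R) (0 : 'rV[int]_d).
have c0 : cos (2 * pi * 4^-1) = 0 :> R.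
  rewrite [X in cos X](_ : _ = pi / 2) ?cos_pihalf//.
  by rewrite -mulrA mulrCA; congr (_ * _); lra.
rewrite c0 mulr0 addr0 => <-; rewrite -[LHS]mul1e -integral_cst; last first.
  exact: measurable_unit_cube.
apply: eq_integral => x _; rewrite /dotZR big1 ?addr0 ?c0 ?addr0//.
by move=> i _; rewrite mxE mul0r.
Qed.


Section cube_integral.
Variables (R : realType) (d : nat).
Local Notation Rd := (d.-tuple (measurableTypeR R)).
Local Notation mu := (@lebesgue_measureRd R d).
Implicit Types (f g : Rd -> R).

Lemma bounded_cube_integrable f M : measurable_fun setT f ->
  (forall x, `|f x| <= M) -> mu.-integrable (unit_cube d) (EFin \o f).
Proof.
move=> mf fM; apply: measurable_bounded_integrable.
- exact: measurable_unit_cube.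
- rewrite [ltLHS](_ : _ = 1%E) ?ltry//; exact: lebesgue_unit_cube.
- exact: measurable_funTS.
- exists M; split; first exact: num_real.
  by move=> y My x _ /=; rewrite (le_trans (fM x))// ltW.
Qed.

Lemma Rintegral_unit_cube_cos (v : 'rV[int]_d) :
  \int[mu]_(x in unit_cube d) cos (2 * pi * dotZR v x) = (v == 0)%:R :> R.
Proof.
have mcos : measurable_fun setT (fun x : Rd => cos (2 * pi * dotZR v x)).
  have := @measurable_cos_dotZR R d 0 v.
  by under eq_fun do rewrite add0r.
have icos : mu.-integrable (unit_cube d)
    (EFin \o (fun x : Rd => cos (2 * pi * dotZR v x))).
  apply: (@bounded_cube_integrable _ 1) => // x.
  by rewrite ler_norml cos_geN1 cos_le1.
have := integral_unit_cube_cos (0 : R) v.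
under eq_integral do rewrite add0r EFinD.
rewrite integralD//=; [|exact: measurable_unit_cube|]; last first.
  by apply: (@bounded_cube_integrable (cst 1) 1) => // x; rewrite normr1.
rewrite integral_cst; last exact: measurable_unit_cube.
rewrite [X in (_ * X)%E](_ : _ = 1%E); last exact: lebesgue_unit_cube.
rewrite mule1 mulr0 cos0 mulr1.
have fi := integrable_fin_num (@measurable_unit_cube R d) icos.
by rewrite -(fineK fi) -EFinD => -[/addrI].
Qed.

Lemma measurable_trig_sum (I : Type) (r : seq I) (c : I -> R) (v : I -> 'rV[int]_d) :
  measurable_fun setT (fun x : Rd => \sum_(i <- r) c i * cos (2 * pi * dotZR (v i) x)).
Proof.
apply: measurable_sum => i; apply: measurable_funM; first exact: measurable_cst.
have := @measurable_cos_dotZR R d 0 (v i).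
by under eq_fun do rewrite add0r.
Qed.

Lemma integrable_trig_sum (I : Type) (r : seq I) (c : I -> R) (v : I -> 'rV[int]_d) :
  mu.-integrable (unit_cube d)
    (EFin \o (fun x => \sum_(i <- r) c i * cos (2 * pi * dotZR (v i) x))).
Proof.
apply: (@bounded_cube_integrable _ (\sum_(i <- r) `|c i|)).
  exact: measurable_trig_sum.
move=> x; rewrite (le_trans (ler_norm_sum _ _ _))// ler_sum// => i _.
by rewrite normrM ler_piMr// ler_norml cos_geN1 cos_le1.
Qed.

Lemma Rintegral_trig_sum (I : Type) (r : seq I) (c : I -> R) (v : I -> 'rV[int]_d) :
  \int[mu]_(x in unit_cube d) (\sum_(i <- r) c i * cos (2 * pi * dotZR (v i) x)) =
  \sum_(i <- r) c i * (v i == 0)%:R.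
Proof.
have mU := @measurable_unit_cube R d.
elim: r => [|i r ih].
  rewrite big_nil -[RHS](mul0r (fine (mu (unit_cube d)))) -Rintegral_cst//.
  by apply: eq_Rintegral => x _; rewrite big_nil.
under eq_Rintegral do rewrite big_cons.
have i1 : mu.-integrable (unit_cube d)
    (EFin \o (fun x => c i * cos (2 * pi * dotZR (v i) x))).
  have := integrable_trig_sum [:: i] c v.
  by under eq_fun do rewrite big_seq1.
rewrite RintegralD//; last exact: integrable_trig_sum.
rewrite ih big_cons RintegralZl ?Rintegral_unit_cube_cos//.
have := integrable_trig_sum [:: i] (cst 1) v.
by under eq_fun do rewrite big_seq1 mul1r.
Qed.

End cube_integral.

(** * Domination by the leading terms *)

Lemma addn_split_sub P Q j l : (P <= j)%N -> (Q <= l)%N ->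
  (j + l = P + Q + (j - P) + (l - Q))%N.
Proof. lia. Qed.

Section gap.
Variables (R : realType) (m k Q : nat) (n : nat -> nat -> nat).
Let P := m.+2.
Hypotheses (k0 : (0 < k)%N) (QP : (Q < P)%N) (oddPQ : odd (P + Q)).
Hypothesis n_le : forall j l, (n j l <= k ^ (j + l))%N.
Hypothesis n_PQ : (0 < n P Q)%N.
Hypothesis n_sym : forall j l, n j l = n l j.
Hypothesis n_odd : forall j l, odd (j + l) -> n j l != 0%N ->
  (P <= j)%N && (Q <= l)%N || (Q <= j)%N && (P <= l)%N.

(** The terms decay with ratio y = (m + 1) k r, and this radius makes k^(P+Q) y = 1/16. Hence even
    the largest possible number k^(P+Q) of coincidences keeps the corrections in y below the leading
    terms. The exponent s does not enter. *)
Definition small_radius : R := (16 * m.+1%:R * k%:R ^+ (m.+2 + Q).+1)^-1.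
Let r := small_radius.
Let y : R := m.+1%:R * k%:R * r.

Let kR : 1 <= k%:R :> R. Proof. by rewrite ler1n. Qed.
Let r0 : 0 < r.
Proof. by rewrite invr_gt0 mulr_gt0 ?exprn_gt0 ?mulr_gt0 ?ltr0n. Qed.
Let ky : k%:R ^+ (P + Q) * y = 16^-1.
Proof.
have kn0 : k%:R != 0 :> R by rewrite gt_eqF// ltr0n.
have mn0 : m.+1%:R != 0 :> R by rewrite gt_eqF// ltr0n.
rewrite /y /r /small_radius -/P exprS.
move: (m.+1%:R) mn0 (k%:R) kn0 => M M0 K K0; field.
by rewrite expf_neq0 ?K0 ?M0.
Qed.
Let y0 : 0 <= y. Proof. by rewrite !mulr_ge0// ltW. Qed.
Let y_le : y <= 16^-1.
Proof. by rewrite -ky ler_peMl// exprn_ege1. Qed.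

Variable s : R.
Hypotheses (ms : m%:R < s) (sm : s < m.+1%:R).
Let c := gbinom s.

Let tail_sum N i : \sum_(j < N) (if (i <= j)%N then y ^+ (j - i) else 0) <= (1 - y)^-1.
Proof.
have y1 : 0 <= y < 1 by rewrite y0 (le_lt_trans y_le)//; lra.
case: (leqP i N) => iN; last first.
  rewrite big1 ?invr_ge0 ?subr_ge0; first by case/andP: y1 => _ /ltW.
  by move=> j _; rewrite ifN// -ltnNge (ltn_trans _ iN).
rewrite -(subnKC iN) big_split_ord/= big1 ?add0r; last first.
  by move=> j _; rewrite ifN// -ltnNge.
under eq_bigr do rewrite leq_addr addKn.
exact: geometric_sum_le.
Qed.

(** A leading term is 2 A times its number of coincidences, and [A'] replaces that number by its
    upper bound k^(P+Q). *)
Let A := - c P * c Q * r ^+ (P + Q).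
Let A' := k%:R ^+ (P + Q) * A.
Let A_gt0 : 0 < A.
Proof.
rewrite mulr_gt0 ?exprn_gt0// mulr_gt0 ?oppr_gt0 ?(gbinom_lt0 ms sm)//.
by rewrite (gbinom_gt0 ms).
Qed.

(** A geometric majorant supported on the quadrant with corner (i, i'). *)
Let g i i' j j' := (if (i <= j)%N then y ^+ (j - i) else 0) *
  (if (i' <= j')%N then y ^+ (j' - i') else 0).

(** The (j, l) term of the integral at radius -r minus the one at radius r. *)
Let t j l := c j * c l * r ^+ (j + l) * ((-1) ^+ (j + l) - 1) * (n j l)%:R.
Let isPQ (j l i i' : nat) := ((j == i) && (l == i'))%:R : R.

Let t_sym j l : t j l = t l j.
Proof. by rewrite /t n_sym addnC [c j * _]mulrC. Qed.

Let t_bound j l : (P <= j)%N -> (Q <= l)%N ->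
  `|t j l| <= 2 * A' * (y ^+ (j - P) * y ^+ (l - Q)).
Proof.
move=> Pj Ql; rewrite /t !normrM.
have h1 := normr_gbinomD ms sm (j - P) P.
have h2 := normr_gbinomD ms sm (l - Q) Q.
rewrite !subnK// in h1 h2.
have h3 : `|(-1) ^+ (j + l) - 1| <= 2 :> R.
  by rewrite -signr_odd; case: odd; rewrite ?expr1 ?expr0 ler_norml; lra.
have h4 : `|(n j l)%:R| <= k%:R ^+ (j + l) :> R.
  by rewrite ger0_norm// -natrX ler_nat.
have h5 : `|r ^+ (j + l)| = r ^+ (j + l) by rewrite ger0_norm// exprn_ge0// ltW.
rewrite h5.
have h12 := ler_pM (normr_ge0 _) (normr_ge0 _) h1 h2.
have r_ge0 : 0 <= r ^+ (j + l) by rewrite exprn_ge0// ltW.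
have h123 := ler_pM (mulr_ge0 (mulr_ge0 (normr_ge0 _) (normr_ge0 _)) r_ge0)
  (normr_ge0 _) (ler_wpM2r r_ge0 h12) h3.
have h := ler_pM (mulr_ge0 (mulr_ge0 (mulr_ge0 (normr_ge0 _) (normr_ge0 _))
  r_ge0) (normr_ge0 _)) (normr_ge0 _) h123 h4.
apply: (le_trans h).
rewrite [`|gbinom s P|]ltr0_norm ?(gbinom_lt0 ms sm)//.
rewrite [`|gbinom s Q|]gtr0_norm ?(gbinom_gt0 ms)//.
rewrite le_eqVlt; apply/orP; left; apply/eqP.
rewrite /A' /A /y.
have -> : r ^+ (j + l) = r ^+ (P + Q) * r ^+ (j - P) * r ^+ (l - Q).
  by rewrite {1}(addn_split_sub Pj Ql) !exprD.
have -> : k%:R ^+ (j + l) = k%:R ^+ (P + Q) * k%:R ^+ (j - P) * k%:R ^+ (l - Q) :> R.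
  by rewrite {1}(addn_split_sub Pj Ql) !exprD.
rewrite !exprMn /c; ring.
Qed.

(** Away from the corner this is [t_bound]. At the corner the majorant -2 A' is traded for the true
    lower bound 2 A, whence the correction 2 A + 2 A'. *)
Let t_ge j l : (P <= j)%N -> (Q <= l)%N ->
  - (2 * A') * g P Q j l + isPQ j l P Q * (2 * A + 2 * A') <= t j l.
Proof.
move=> Pj Ql; rewrite /isPQ; have := t_bound Pj Ql; rewrite /g Pj Ql.
case: eqP => [->|_]/=; last first.
  by rewrite mul0r addr0 ler_norml => /andP[+ _]; rewrite mulNr.
case: eqP => [->|_]/=; last first.
  by rewrite mul0r addr0 ler_norml => /andP[+ _]; rewrite mulNr.
move=> _; rewrite !subnn !expr0 !mulr1 mul1r.
rewrite addrCA addNr addr0.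
rewrite /t -signr_odd oddPQ expr1.
have n1 : 1 <= (n P Q)%:R :> R by rewrite ler1n.
have -> : c P * c Q * r ^+ (P + Q) * (-1 - 1) * (n P Q)%:R = 2 * A * (n P Q)%:R.
  by rewrite /A; ring.
by rewrite ler_peMr// mulr_ge0// ltW.
Qed.

Lemma small_radius_gt0 : 0 < small_radius.
Proof. exact: r0. Qed.

Lemma small_radius_le : m.+1%:R * k%:R * small_radius <= 16^-1.
Proof. exact: y_le. Qed.

(** Outside the two quadrants with corners (P, Q) and (Q, P) every term vanishes, by parity or by
    [n_odd]. Inside, both majorants may be subtracted even where the quadrants overlap, and since Q
    < P neither corner lies in the other quadrant. *)
Lemma majorant_gap N : (P <= N)%N ->
  - c P * c Q * r ^+ (P + Q) <= \sum_(j < N.+1) \sum_(l < N.+1)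
    c j * c l * r ^+ (j + l) * ((-1) ^+ (j + l) - 1) * (n j l)%:R.
Proof.
move=> PN; rewrite -/A.
have A'0 : 0 <= A' by rewrite mulr_ge0 ?exprn_ge0// ltW.
have tL j l : - (2 * A') * (g P Q j l + g Q P j l) +
    (isPQ j l P Q + isPQ j l Q P) * (2 * A + 2 * A') <= t j l.
  have gge i i' a b : 0 <= g i i' a b.
    by rewrite mulr_ge0//; case: ifP => // _; rewrite exprn_ge0.
  have g0 i i' a b : - (2 * A') * g i i' a b <= 0.
    by rewrite mulNr oppr_le0 mulr_ge0 ?gge// mulr_ge0.
  have isQP0 : (P <= j)%N -> (Q <= l)%N -> isPQ j l Q P = 0.
    by rewrite /isPQ => Pj _; case: eqP => //; lia.
  have isPQ0 : (Q <= j)%N -> (P <= l)%N -> isPQ j l P Q = 0.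
    by rewrite /isPQ => _ Pl; case: (l =P Q) => [|_]; [lia|rewrite andbF].
  rewrite mulrDr; have := g0 Q P j l; have := g0 P Q j l.
  case: (boolP ((P <= j)%N && (Q <= l)%N)) => [/andP[Pj Ql]|nPQ].
    by have := t_ge Pj Ql; rewrite isQP0// addr0; lra.
  case: (boolP ((Q <= j)%N && (P <= l)%N)) => [/andP[Qj Pl]|nQP].
    have := t_ge Pl Qj; rewrite t_sym isPQ0// add0r.
    have -> : g P Q l j = g Q P j l by rewrite /g mulrC.
    have -> : isPQ l j P Q = isPQ j l Q P by rewrite /isPQ andbC.
    by lra.
  have -> : isPQ j l P Q = 0.
    rewrite /isPQ; case: eqP => [e|//]; case: eqP => [e'|//].
    by move: nPQ; rewrite e e' !leqnn.
  have -> : isPQ j l Q P = 0.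
    rewrite /isPQ; case: eqP => [e|//]; case: eqP => [e'|//].
    by move: nQP; rewrite e e' !leqnn.
  have -> : t j l = 0.
    rewrite /t -signr_odd; case: (boolP (odd (j + l))) => [jlo|_]; last first.
      by rewrite subrr mulr0 mul0r.
    have [->|n0] := eqVneq (n j l) 0%N; first by rewrite mulr0.
    by have := n_odd jlo n0; rewrite (negbTE nPQ) (negbTE nQP).
  by lra.
have sumg i i' : \sum_(j < N.+1) \sum_(l < N.+1) g i i' j l <= ((1 - y)^-1) ^+ 2.
  under eq_bigr do rewrite -mulr_sumr.
  rewrite -mulr_suml expr2 ler_pM ?tail_sum// sumr_ge0// => j _;
    by case: ifP => // _; exact: exprn_ge0.
have sumPQ i i' : (i <= N)%N -> (i' <= N)%N ->
    \sum_(j < N.+1) \sum_(l < N.+1) isPQ j l i i' = 1.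
  move=> iN i'N; rewrite (bigD1 (inord i))//= (bigD1 (inord i'))//=.
  rewrite /isPQ !inordK// !eqxx big1 ?big1 ?addr0// => [j|l] ne.
    apply: big1 => l _; case: eqP => // ji.
    by case/eqP: ne; apply: val_inj; rewrite /= inordK.
  case: eqP => // li'.
  by case/eqP: ne; apply: val_inj; rewrite /= inordK.
apply: (@le_trans _ _ (\sum_(j < N.+1) \sum_(l < N.+1)
    (- (2 * A') * (g P Q j l + g Q P j l) +
    (isPQ j l P Q + isPQ j l Q P) * (2 * A + 2 * A')))); last first.
  by apply: ler_sum => j _; apply: ler_sum => l _; exact: tL.
have -> : \sum_(j < N.+1) \sum_(l < N.+1) (- (2 * A') * (g P Q j l + g Q P j l) +
    (isPQ j l P Q + isPQ j l Q P) * (2 * A + 2 * A')) =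
  - (2 * A') * (\sum_(j < N.+1) \sum_(l < N.+1) g P Q j l +
    \sum_(j < N.+1) \sum_(l < N.+1) g Q P j l)
   + 2 * (2 * A + 2 * A').
  under eq_bigr do rewrite big_split/= -mulr_sumr -mulr_suml !big_split/=.
  rewrite big_split/= -mulr_sumr -mulr_suml !big_split/= !sumPQ//.
  exact: leq_trans (ltnW QP) PN.
  exact: leq_trans (ltnW QP) PN.
(* Each sum of [g] is at most 1 + 4 y, so the total is at least 4 A + 4 A' - 4 A' (1 + 4 y) = 4 A -
   16 A' y = 3 A. *)
have := sumg P Q; have := sumg Q P.
move: (\sum_(_ < _) _) (\sum_(_ < _) _) => S1 S2 h1 h2.
have y2 : (1 - y)^-1 ^+ 2 <= 1 + 4 * y.
  have y1 : 0 < 1 - y by move: y_le; lra.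
  rewrite exprVn -[leLHS]mul1r ler_pdivrMr ?exprn_gt0//.
  by move: y_le y0; nra.
have A'y : A' * y = A / 16 by rewrite /A' mulrAC ky mulrC.
have : A' * S1 <= A' * (1 + 4 * y) by rewrite ler_wpM2l// (le_trans _ y2).
have : A' * S2 <= A' * (1 + 4 * y) by rewrite ler_wpM2l// (le_trans _ y2).
rewrite !mulrDr mulrCA A'y mulr1.
have := A_gt0.
lra.
Qed.

End gap.

(** * Coincidences between words *)

Definition int_pos (x : int) : nat := if 0 <= x then `|x|%N else 0%N.

Lemma int_posB (x : int) : (int_pos x)%:Z - (int_pos (- x))%:Z = x.
Proof. by rewrite /int_pos; case: ifP; case: ifP; lia. Qed.

Definition word_sum k d (u : 'I_k -> 'rV[int]_d) j (f : {ffun 'I_j -> 'I_k}) :=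
  \sum_i u (f i).

(** For G the sum of the e(u_i . x), this is the integral over the cube of G^j times the conjugate
    of G^l. *)
Definition coincidences k d (u : 'I_k -> 'rV[int]_d) (j l : nat) : nat :=
  \sum_(f : {ffun 'I_j -> 'I_k}) \sum_(g : {ffun 'I_l -> 'I_k})
    (word_sum u f == word_sum u g).

Section coincidences.
Variables (k d : nat) (u : 'I_k -> 'rV[int]_d).

Lemma coincidences_sym j l : coincidences u j l = coincidences u l j.
Proof.
rewrite /coincidences exchange_big/=.
by apply: eq_bigr => f _; apply: eq_bigr => g _; rewrite eq_sym.
Qed.

Lemma coincidences_le j l : (coincidences u j l <= k ^ (j + l))%N.
Proof.
apply: (@leq_trans (\sum_(f : {ffun 'I_j -> 'I_k}) \sum_(g : {ffun 'I_l -> 'I_k}) 1)%N).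
  by apply: leq_sum => f _; apply: leq_sum => g _; exact: leq_b1.
by rewrite sum1_card sum_nat_const !card_ffun !card_ord expnD.
Qed.

Lemma word_with_counts (n : 'I_k -> nat) :
  exists f : {ffun 'I_(\sum_i n i) -> 'I_k}, word_sum u f = \sum_i u i *+ n i.
Proof.
pose w := flatten [seq nseq (n i) i | i <- enum 'I_k].
have sw : size w == (\sum_i n i)%N.
  rewrite size_flatten /shape -map_comp sumnE big_map big_enum.
  by apply/eqP/eq_bigr => i _ /=; rewrite size_nseq.
have sumw N (e : size w == N) :
    \sum_t u ([ffun t => tnth (Tuple e) t] t) = \sum_(i <- w) u i.
  rewrite -[w]/(tval (Tuple e)) big_tuple.
  by apply: eq_bigr => t _; rewrite ffunE.
exists [ffun t => tnth (Tuple sw) t]; rewrite /word_sum sumw /w.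
rewrite big_flatten/= big_map big_enum/=.
apply: eq_bigr => i _; elim: (n i) => [|c ih]; rewrite ?big_nil//= big_cons ih.
by rewrite mulrS.
Qed.

Lemma word_sum_counts j (f : {ffun 'I_j -> 'I_k}) :
  word_sum u f = \sum_i u i *+ #|[pred t | f t == i]|.
Proof.
rewrite /word_sum (partition_big f xpredT)//=; apply: eq_bigr => i _.
rewrite (eq_bigr (fun=> u i)); last by move=> t /eqP ->.
by rewrite sumr_const.
Qed.

Lemma sum_counts j (f : {ffun 'I_j -> 'I_k}) :
  (\sum_i #|[pred t | f t == i]| = j)%N.
Proof.
rewrite -[RHS]card_ord -sum1_card (partition_big f xpredT)//=.
by apply: eq_bigr => i _; rewrite sum1_card.
Qed.

Variable lam : 'I_k -> int.
Hypothesis lam_rel : \sum_i lam i *: u i = 0.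
Hypothesis lam_gen : forall mu : 'I_k -> int, \sum_i mu i *: u i = 0 ->
  exists t, forall i, mu i = t * lam i.

(** These two weights are the numbers P and Q of the overview. *)
Definition pos_weight := (\sum_i int_pos (lam i))%N.
Definition neg_weight := (\sum_i int_pos (- lam i))%N.

Lemma weight_diff : pos_weight%:Z - neg_weight%:Z = \sum_i lam i.
Proof.
rewrite /pos_weight /neg_weight -!natz !natr_sum -sumrB; apply: eq_bigr => i _.
by rewrite !natz int_posB.
Qed.

(** Moving the negative terms of the relation to the other side equates a word sum of length P with
    one of length Q. *)
Lemma coincidences_gt0 : (0 < coincidences u pos_weight neg_weight)%N.
Proof.
have [f fE] := word_with_counts (fun i => int_pos (lam i)).
have [g gE] := word_with_counts (fun i => int_pos (- lam i)).
rewrite /coincidences (bigD1 f)//= (bigD1 g)//= fE gE.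
suff -> : \sum_i u i *+ int_pos (lam i) =
   \sum_i u i *+ int_pos (- lam i) by rewrite eqxx.
apply/eqP; rewrite -subr_eq0 -sumrB -[X in _ == X]lam_rel; apply/eqP/eq_bigr => i _.
rewrite -!scaler_nat -scalerBl; congr (_ *: _).
by rewrite !natz int_posB.
Qed.

Lemma coincidences_odd j l : odd (pos_weight + neg_weight) ->
  odd (j + l) -> coincidences u j l != 0%N ->
  (pos_weight <= j)%N && (neg_weight <= l)%N ||
  (neg_weight <= j)%N && (pos_weight <= l)%N.
Proof.
move=> oPQ ojl.
rewrite sum_nat_eq0 negb_forall => /existsP[f]; rewrite /= sum_nat_eq0.
rewrite negb_forall => /existsP[g]/=; rewrite eqb0 negbK => /eqP efg.
pose cf i : nat := #|[pred t | f t == i]|; pose cg i : nat := #|[pred t | g t == i]|.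
have rel : \sum_i ((cf i)%:Z - (cg i)%:Z) *: u i = 0.
  move: efg; rewrite !word_sum_counts => /eqP; rewrite -subr_eq0 -sumrB => /eqP e.
  by rewrite -[RHS]e; apply: eq_bigr => i _; rewrite scalerBl -!scaler_nat !natz.
have [t tE] := lam_gen rel.
have jE : j = (\sum_i cf i)%N by rewrite sum_counts.
have lE : l = (\sum_i cg i)%N by rewrite sum_counts.
(* The letter counts differ by t times [lam]. For t > 0 the counts of f dominate the positive parts
   of [lam] and those of g the negative parts; t < 0 exchanges the roles; t = 0 gives j = l, against
   parity. *)
have [t0|t0|t0] := ltrgtP t 0.
- apply/orP; right; rewrite jE lE /pos_weight /neg_weight; apply/andP; split.
    by apply: leq_sum => i _; have := tE i; rewrite /int_pos; case: ifP; nia.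
  by apply: leq_sum => i _; have := tE i; rewrite /int_pos; case: ifP; nia.
- apply/orP; left; rewrite jE lE /pos_weight /neg_weight; apply/andP; split.
    by apply: leq_sum => i _; have := tE i; rewrite /int_pos; case: ifP; nia.
  by apply: leq_sum => i _; have := tE i; rewrite /int_pos; case: ifP; nia.
have : j = l.
  rewrite jE lE; apply: eq_bigr => i _; have := tE i; rewrite t0 mul0r.
  by lia.
by move=> e; move: ojl; rewrite e addnn odd_double.
Qed.

End coincidences.

Lemma pos_weight_dim k (lam : 'I_k -> int) : (0 < pos_weight lam)%N -> (0 < k)%N.
Proof. by case: k lam => // lam; rewrite /pos_weight big_ord0. Qed.

(** Passing to differences with p_c turns affine relations into linear ones. The coefficients [mu]
    sum to -lam_c, so P - Q is positive and odd. *)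
Lemma centered_circuit d k (p : 'I_k.+1 -> 'rV[int]_d) (lam : 'I_k.+1 -> int) c
    (u := fun i => p (lift c i) - p c) (mu := fun i => lam (lift c i)) M :
  affine_relation p lam ->
  (forall nu, affine_relation p nu -> exists t, forall i, nu i = t * lam i) ->
  (exists i, (M < `|lam i|)%N) -> odd `|lam c| -> lam c < 0 ->
  [/\ \sum_i mu i *: u i = 0,
      forall nu : 'I_k -> int, \sum_i nu i *: u i = 0 ->
        exists t, forall i, nu i = t * mu i,
      (neg_weight mu < pos_weight mu)%N,
      odd (pos_weight mu + neg_weight mu) & (M < pos_weight mu)%N].
Proof.
move=> [rl1 rl2] gl [i0 Mi0] oc c0.
have summu : \sum_i mu i = - lam c.
  by move: rl1; rewrite (bigD1_ord c)//= addrC => /eqP; rewrite addr_eq0 => /eqP.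
have := weight_diff mu; rewrite summu => wd.
split.
- under eq_bigr do rewrite /u scalerBr.
  rewrite sumrB -scaler_suml summu scaleNr opprK addrC -[RHS]rl2.
  by rewrite [RHS](bigD1_ord c).
- move=> nu rnu.
  (* The coefficient at c is chosen to make the total zero, which recovers an affine relation from a
     linear one. *)
  pose nu' i := if unlift c i is Some j then nu j else - \sum_j nu j.
  have nu'c : nu' c = - \sum_j nu j by rewrite /nu' unlift_none.
  have nu'l j : nu' (lift c j) = nu j by rewrite /nu' liftK.
  have [|t tE] := gl nu'; last by exists t => i; rewrite -nu'l tE.
  split.
    rewrite (bigD1_ord c)//= nu'c; under eq_bigr do rewrite nu'l.
    by rewrite addNr.
  rewrite (bigD1_ord c)//= nu'c; under eq_bigr do rewrite nu'l.
  rewrite -[RHS]rnu /u; under [RHS]eq_bigr do rewrite scalerBr.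
  by rewrite sumrB -scaler_suml scaleNr addrC.
- by move: wd c0; lia.
- by move: wd oc; lia.
have pos_ge j : (int_pos (mu j) <= pos_weight mu)%N.
  by rewrite /pos_weight (bigD1 j)//= leq_addr.
have neg_ge j : (int_pos (- mu j) <= neg_weight mu)%N.
  by rewrite /neg_weight (bigD1 j)//= leq_addr.
(* A large entry away from c is at most P or at most Q < P in absolute value; the one at c has
   absolute value P - Q. Either way P exceeds M. *)
case: (unliftP c i0) Mi0 => [j ->|->]; last by move: wd c0; lia.
rewrite -/(mu j); have := pos_ge j; have := neg_ge j; rewrite /int_pos.
by move: wd c0; case: ifP; case: ifP; lia.
Qed.

Lemma infinite_centered_circuit d (Gamma : set 'rV[int]_d) M :
  infinite_set Gamma ->
  exists k (p : 'I_k.+1 -> 'rV[int]_d) c (mu : 'I_k -> int),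
    [/\ injective p, forall i, Gamma (p i) &
    let u := fun i => p (lift c i) - p c in
    [/\ \sum_i mu i *: u i = 0,
      forall nu : 'I_k -> int, \sum_i nu i *: u i = 0 ->
        exists t, forall i, nu i = t * mu i,
      (neg_weight mu < pos_weight mu)%N,
      odd (pos_weight mu + neg_weight mu) & (M < pos_weight mu)%N]].
Proof.
move=> /(infinite_unbounded_circuit M)[k [p [lam [pI pG rl gl ub]]]].
(* If all entries were even, [lam] / 2 would be a relation and hence an integer multiple t of [lam];
   then (1 - 2 t) lam_i = 0 at a nonzero entry. *)
have [c oc] : exists c, odd `|lam c|.
  apply/not_existsP => even_lam.
  have lam2 i : lam i = 2 * (lam i %/ 2)%Z.
    by have := even_lam i; lia.
  have [i Mi] := ub.
  have [|t tE] := gl (fun i => (lam i %/ 2)%Z).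
    case: rl => r1 r2; split.
      have : 2 * \sum_i (lam i %/ 2)%Z = 0.
        by rewrite mulr_sumr -[RHS]r1; apply: eq_bigr => j _; rewrite -lam2.
      by lia.
    have : 2%:Z *: (\sum_i (lam i %/ 2)%Z *: p i) = 0.
      rewrite scaler_sumr -[RHS]r2; apply: eq_bigr => j _.
      by rewrite scalerA -lam2.
    move: (\sum_j _) => v /rowP v0; apply/rowP => j.
    by have := v0 j; rewrite !mxE; lia.
  have := tE i; have := lam2 i; move: Mi.
  set h := (_ %/ _)%Z; move=> Mi e1 e2; have : (1 - 2 * t) * lam i = 0.
    by rewrite mulrBl -mulrA -e2 -e1; lia.
  by move/eqP; rewrite mulf_eq0; lia.
(* A generator may be replaced by its opposite, which makes the odd entry negative. *)
have [c0|c0] : lam c < 0 \/ 0 < lam c by lia.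
  exists k, p, c, (fun i => lam (lift c i)); split => //.
  exact: centered_circuit.
exists k, p, c, (fun i => - lam (lift c i)); split => //.
apply: (@centered_circuit _ _ _ (fun i => - lam i)) => //.
- case: rl => r1 r2; split; first by rewrite sumrN r1 oppr0.
  by under eq_bigr do rewrite scaleNr; rewrite sumrN r2 oppr0.
- move=> nu /gl[t tE]; exists (- t) => i; by rewrite tE mulrNN.
- by have [i Mi] := ub; exists i; rewrite abszN.
- by rewrite abszN.
- by rewrite oppr_lt0.
Qed.

(** * Exponential sums *)

Section exponentials.
Variable R : realType.
Implicit Types a b : R.

Lemma e2piD a b : e2pi (a + b) = e2pi a * e2pi b.
Proof. by rewrite /e2pi mulrDr cosD sinD [X in (_ +i* X)%C]addrC. Qed.

Lemma e2pi0 : e2pi 0 = 1 :> R[i].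
Proof. by rewrite /e2pi mulr0 cos0 sin0. Qed.

Lemma normc_e2pi a : normc (e2pi a) = 1.
Proof. by rewrite /= cos2Dsin2 sqrtr1. Qed.

Lemma normc_real a : normc a%:C%C = `|a|.
Proof. by rewrite /= expr0n addr0 sqrtr_sqr. Qed.

Lemma sqr_normc_trig_sum (I : finType) (c th : I -> R) :
  normc (\sum_i (c i)%:C%C * e2pi (th i)) ^+ 2 =
  \sum_i \sum_j c i * c j * cos (2 * pi * (th i - th j)).
Proof.
rewrite sqr_normcE !raddf_sum/= !expr2 !big_distrlr/= -big_split/=.
apply: eq_bigr => i _; rewrite -big_split/=; apply: eq_bigr => j _.
by rewrite (mulrBr (2 * pi : R)) cosB; ring.
Qed.

Variables (d : nat).
Implicit Types x : d.-tuple (measurableTypeR R).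

Lemma dotZRD v w x : dotZR (v + w) x = dotZR v x + dotZR w x.
Proof.
rewrite /dotZR -big_split/=; apply: eq_bigr => i _.
by rewrite mxE intrD mulrDl.
Qed.

Lemma dotZRN v x : dotZR (- v) x = - dotZR v x.
Proof.
by rewrite /dotZR -sumrN; apply: eq_bigr => i _; rewrite mxE intrN mulNr.
Qed.

Lemma dotZR0 x : dotZR 0 x = 0.
Proof. by rewrite /dotZR big1// => i _; rewrite mxE mul0r. Qed.

Variables (k : nat) (u : 'I_k -> 'rV[int]_d).

Lemma exp_sumX j x : (\sum_i e2pi (dotZR (u i) x)) ^+ j =
  \sum_(f : {ffun 'I_j -> 'I_k}) e2pi (dotZR (word_sum u f) x).
Proof.
have -> : (\sum_i e2pi (dotZR (u i) x)) ^+ j =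
    \prod_(t < j) \sum_i e2pi (dotZR (u i) x).
  by rewrite prodr_const card_ord.
rewrite bigA_distr_bigA/=; apply: eq_bigr => f _; rewrite /word_sum.
rewrite (big_morph (fun v => dotZR v x) (fun v w => dotZRD v w x) (dotZR0 x)).
by rewrite (big_morph _ e2piD e2pi0).
Qed.

(** Words of length at most N form one finite type, so that the truncated series is a single sum of
    exponentials. *)
Let word N := {j : 'I_N.+1 & {ffun 'I_j -> 'I_k}}.

Lemma sqr_normc_binomial_sum (s r : R) N x :
  normc (binomial_sum s N (r%:C%C * \sum_i e2pi (dotZR (u i) x))) ^+ 2 =
  \sum_(w : word N * word N)
    (gbinom s (tag w.1) * r ^+ tag w.1 * (gbinom s (tag w.2) * r ^+ tag w.2)) *
    cos (2 * pi * dotZR (word_sum u (tagged w.1) - word_sum u (tagged w.2)) x).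
Proof.
have -> : binomial_sum s N (r%:C%C * \sum_i e2pi (dotZR (u i) x)) =
    \sum_(w : word N) (gbinom s (tag w) * r ^+ tag w)%:C%C *
      e2pi (dotZR (word_sum u (tagged w)) x).
  rewrite /binomial_sum; under eq_bigr do rewrite exprMn exp_sumX mulrA mulr_sumr.
  rewrite sig_big_dep/=; apply: eq_bigr => w _.
  by rewrite -rmorphXn -rmorphM.
rewrite sqr_normc_trig_sum pair_big/=; apply: eq_bigr => w _.
by rewrite dotZRD dotZRN.
Qed.

(** Orthogonality keeps exactly the pairs of words with equal sums. *)
Lemma Rintegral_sqr_binomial_sum (s r : R) N :
  \int[lebesgue_measureRd d]_(x in unit_cube d)
    (normc (binomial_sum s N (r%:C%C * \sum_i e2pi (dotZR (u i) x))) ^+ 2) =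
  \sum_(j < N.+1) \sum_(l < N.+1)
    gbinom s j * gbinom s l * r ^+ (j + l) * (coincidences u j l)%:R.
Proof.
under eq_Rintegral do rewrite sqr_normc_binomial_sum.
rewrite Rintegral_trig_sum -(pair_big xpredT xpredT (fun w w' : word N =>
  gbinom s (tag w) * r ^+ tag w * (gbinom s (tag w') * r ^+ tag w') *
  (word_sum u (tagged w) - word_sum u (tagged w') == 0)%:R))/=.
rewrite -(sig_big_dep xpredT (fun _ => xpredT)
  (fun j (f : {ffun 'I_(j : 'I_N.+1) -> 'I_k}) => \sum_(w' : word N)
  gbinom s j * r ^+ j * (gbinom s (tag w') * r ^+ tag w') *
  (word_sum u f - word_sum u (tagged w') == 0)%:R))/=.
apply: eq_bigr => j _.
transitivity (\sum_(f : {ffun 'I_j -> 'I_k}) \sum_(l < N.+1)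
  \sum_(g : {ffun 'I_l -> 'I_k})
  gbinom s j * r ^+ j * (gbinom s l * r ^+ l) *
  (word_sum u f - word_sum u g == 0)%:R).
  by apply: eq_bigr => f _; rewrite sig_big_dep.
rewrite exchange_big/=; apply: eq_bigr => l _.
rewrite /coincidences natr_sum mulr_sumr; apply: eq_bigr => f _.
rewrite natr_sum mulr_sumr; apply: eq_bigr => g _.
by rewrite subr_eq0 exprD; ring.
Qed.

Lemma integrable_sqr_binomial_sum (s r : R) N :
  (lebesgue_measureRd d).-integrable (unit_cube d) (EFin \o (fun x =>
    normc (binomial_sum s N (r%:C%C * \sum_i e2pi (dotZR (u i) x))) ^+ 2)).
Proof.
under eq_fun do rewrite /= sqr_normc_binomial_sum.
exact: integrable_trig_sum.
Qed.

Lemma measurable_normc_exp_sum (a r : R) :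
  measurable_fun setT (fun x => normc (a%:C%C + r%:C%C * \sum_i e2pi (dotZR (u i) x))).
Proof.
have msum (h : R -> R) : continuous h -> measurable_fun setT
    (fun x : d.-tuple (measurableTypeR R) => \sum_i h (2 * pi * dotZR (u i) x)).
  move=> ch; apply: measurable_sum => i; apply: measurableT_comp.
    exact: continuous_measurable_fun.
  by apply: measurable_funM; [exact: measurable_cst|exact: measurable_dotZR].
have -> : (fun x => normc (a%:C%C + r%:C%C * \sum_i e2pi (dotZR (u i) x))) =
    (fun x => Num.sqrt ((a + r * \sum_i cos (2 * pi * dotZR (u i) x)) ^+ 2 +
                        (r * \sum_i sin (2 * pi * dotZR (u i) x)) ^+ 2)).
  apply/funext => x; rewrite -[LHS]ger0_norm ?normc_ge0// -sqrtr_sqr sqr_normcE.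
  have ReS : complex.Re (\sum_i e2pi (dotZR (u i) x)) =
    \sum_i cos (2 * pi * dotZR (u i) x) by rewrite raddf_sum.
  have ImS : complex.Im (\sum_i e2pi (dotZR (u i) x)) =
    \sum_i sin (2 * pi * dotZR (u i) x) by rewrite raddf_sum.
  rewrite -ReS -ImS; case: (\sum_i e2pi _) => A B /=.
  by rewrite !mul0r subr0 addr0 add0r.
apply: measurableT_comp.
  by apply: continuous_measurable_fun; exact: sqrt_continuous.
apply: measurable_funD; apply: measurable_funX.
  apply: measurable_funD => //; apply: measurable_funM => //.
  by apply: msum; exact: continuous_cos.
apply: measurable_funM => //.
by apply: msum; exact: continuous_sin.
Qed.

Lemma normc_exp_sum_le x : normc (\sum_i e2pi (dotZR (u i) x)) <= k%:R.
Proof.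
have -> : k%:R = \sum_(i < k) 1 :> R by rewrite sumr_const card_ord.
elim/big_ind2: _ => [|a b a' b' aa' bb'|i _]; first by rewrite normc0.
  by rewrite (le_trans (le_normcD _ _))// lerD.
by rewrite normc_e2pi.
Qed.

End exponentials.

(** * Comparison of the two integrals *)

Section integral_gap.
Variables (R : realType) (d k m : nat) (u : 'I_k -> 'rV[int]_d) (mu : 'I_k -> int).
Hypothesis mu_rel : \sum_i mu i *: u i = 0.
Hypothesis mu_gen : forall nu : 'I_k -> int, \sum_i nu i *: u i = 0 ->
  exists t, forall i, nu i = t * mu i.
Hypothesis pos_mu : pos_weight mu = m.+2.
Hypothesis neg_lt_pos : (neg_weight mu < pos_weight mu)%N.
Hypothesis odd_mu : odd (pos_weight mu + neg_weight mu).
Local Notation Rd := (d.-tuple (measurableTypeR R)).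
Local Notation leb := (@lebesgue_measureRd R d).
Let G (x : Rd) : R[i] := \sum_i e2pi (dotZR (u i) x).
(** The radius is fixed before s, because the same coefficients must serve every exponent in the
    interval. *)
Let r : R := small_radius R m k (neg_weight mu).

Variable s : R.
Hypotheses (ms : m%:R < s) (sm : s < m.+1%:R).

Let k_gt0 : (0 < k)%N.
Proof. by apply: (@pos_weight_dim _ mu); rewrite pos_mu. Qed.

Let r_gt0 : 0 < r. Proof. exact: small_radius_gt0. Qed.

Let small (e : R) x : `|e| = r -> m.+1%:R * normc (e%:C%C * G x) <= 4^-1.
Proof.
move=> er; rewrite normcM normc_real er.
have h : m.+1%:R * (r * normc (G x)) <= m.+1%:R * (r * k%:R).
  by rewrite ler_wpM2l// ler_wpM2l ?normc_exp_sum_le// ltW.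
apply: (le_trans h); rewrite [r * _]mulrC mulrA.
by rewrite (le_trans (small_radius_le _ _ _ k_gt0))//; lra.
Qed.

Let normc_le (e : R) x : `|e| = r -> normc (1 + e%:C%C * G x) <= 2.
Proof.
move=> er; rewrite (le_trans (le_normcD _ _))// normc1.
have := small x er; have : normc (e%:C%C * G x) <= m.+1%:R * normc (e%:C%C * G x).
  by rewrite ler_peMl ?normc_ge0// ler1n.
by lra.
Qed.

Lemma integrable_powR_exp_sum (e : R) : `|e| = r ->
  leb.-integrable (unit_cube d)
    (EFin \o (fun x => normc (1 + e%:C%C * G x) `^ (2 * s))).
Proof.
move=> er; have s0 : 0 < s by rewrite (le_lt_trans _ ms).
apply: (@bounded_cube_integrable _ _ _ (2 `^ (2 * s))).
  apply: (measurableT_comp (measurable_powR _)).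
  exact: (measurable_normc_exp_sum u 1 e).
move=> x; rewrite ger0_norm ?powR_ge0// ge0_ler_powR// ?nnegrE ?normc_ge0//.
  by rewrite mulr_ge0// ltW.
exact: normc_le.
Qed.

(** Both integrands are uniformly within [eps] of their truncations. The truncated integrals differ
    by at least [A], which does not depend on N, so N is taken large enough for 2 [eps] < [A]. *)
Lemma integral_gap :
  \int[leb]_(x in unit_cube d) (normc (1 + r%:C%C * G x) `^ (2 * s)) <
  \int[leb]_(x in unit_cube d) (normc (1 + (- r)%:C%C * G x) `^ (2 * s)).
Proof.
have arith (a i j e : R) : a <= i - j -> 2 * e < a -> j + e < i - e by lra.
have mU := @measurable_unit_cube R d.
pose c := gbinom s; pose Q := neg_weight mu; pose P := m.+2.
pose A := - c P * c Q * r ^+ (P + Q).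
have A0 : 0 < A.
  rewrite mulr_gt0 ?exprn_gt0// mulr_gt0 ?oppr_gt0 ?(gbinom_lt0 ms sm)//.
  by apply: (gbinom_gt0 ms); rewrite -ltnS -pos_mu.
pose K := 12 * 4 `^ s * 4 `^ (s + 1).
have K0 : 0 <= K by rewrite !mulr_ge0 ?powR_ge0.
(* N >= P brings the leading terms into the truncation; N beyond 2 K / A gives 2 K < A 2^N because N
   < 2^N. *)
pose N := maxn P (Num.bound (2 * K / A)).
have PN : (P <= N)%N by rewrite leq_maxl.
pose eps := K * 2^-1 ^+ N.
have eps_lt : 2 * eps < A.
  rewrite /eps mulrA exprVn ltr_pdivrMr ?exprn_gt0// -ltr_pdivrMl// mulrC.
  have KA0 : 0 <= 2 * K / A by apply: divr_ge0; [exact: mulr_ge0|exact: ltW].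
  rewrite (lt_trans (archi_boundP KA0))//.
  by rewrite -natrX ltr_nat (leq_ltn_trans _ (ltn_expl N _))// leq_maxr.
pose S (e : R) x := normc (binomial_sum s N (e%:C%C * G x)) ^+ 2.
have approx (e : R) x : `|e| = r ->
    S e x - eps <= normc (1 + e%:C%C * G x) `^ (2 * s) <= S e x + eps.
  move=> er; have := binomial_sum_approx ms sm (small x er) N.
  by rewrite distrC ler_distl.
have gap : A <= \int[leb]_(x in unit_cube d) S (- r) x -
    \int[leb]_(x in unit_cube d) S r x.
  rewrite !Rintegral_sqr_binomial_sum -sumrB.
  under eq_bigr do rewrite -sumrB.
  have QP : (Q < P)%N by rewrite /P -pos_mu.
  have oPQ : odd (P + Q) by rewrite /P -pos_mu.
  have cPQ : (0 < coincidences u P Q)%N.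
    by rewrite /P -pos_mu; exact: coincidences_gt0.
  have codd j l : odd (j + l) -> coincidences u j l != 0%N ->
      (P <= j)%N && (Q <= l)%N || (Q <= j)%N && (P <= l)%N.
    by rewrite /P -pos_mu; exact: coincidences_odd.
  have := majorant_gap k_gt0 QP oPQ (coincidences_le u) cPQ
    (coincidences_sym u) codd ms sm PN.
  move=> /le_trans; apply.
  rewrite le_eqVlt; apply/orP; left; apply/eqP.
  apply: eq_bigr => j _; apply: eq_bigr => l _.
  by rewrite -/r (exprNn r) /c; ring.
have iS e : leb.-integrable (unit_cube d) (EFin \o S e).
  exact: integrable_sqr_binomial_sum.
have rN : `|- r| = r by rewrite normrN gtr0_norm.
have rr : `|r| = r by rewrite gtr0_norm.
have iU : leb.-integrable (unit_cube d) (EFin \o cst eps).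
  by apply: (@bounded_cube_integrable _ _ _ `|eps|).
have inteps : \int[leb]_(x in unit_cube d) (cst eps x) = eps.
  rewrite Rintegral_cst//= [X in fine X](_ : _ = 1%E) ?mulr1//.
  exact: lebesgue_unit_cube.
have up : \int[leb]_(x in unit_cube d) (normc (1 + r%:C%C * G x) `^ (2 * s)) <=
    \int[leb]_(x in unit_cube d) S r x + eps.
  rewrite -[in leRHS]inteps -RintegralD//.
  apply: le_Rintegral => //.
  - exact: integrable_powR_exp_sum.
  - exact: (integrableD mU (iS r) iU).
  - by move=> x _; have /andP[] := approx r x rr.
have lo : \int[leb]_(x in unit_cube d) S (- r) x - eps <=
    \int[leb]_(x in unit_cube d) (normc (1 + (- r)%:C%C * G x) `^ (2 * s)).
  rewrite -[in leLHS]inteps -RintegralB//.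
  apply: le_Rintegral => //.
  - exact: (integrableB mU (iS (- r)) iU).
  - exact: integrable_powR_exp_sum.
  - by move=> x _; have /andP[] := approx (- r) x rN.
exact: le_lt_trans up (lt_le_trans (arith _ _ _ _ gap eps_lt) lo).
Qed.

End integral_gap.

(** * Exponential sums supported on a circuit, and the conclusion *)

Lemma expsum_codom (R : realType) d k (Gamma : set 'rV[int]_d)
    (p : 'I_k -> 'rV[int]_d) (a : 'rV[int]_d -> R) x :
  injective p -> (forall i, Gamma (p i)) ->
  (forall n, n \notin codom p -> a n = 0) ->
  expsum Gamma a x = \sum_i (a (p i))%:C%C * e2pi (dotZR (p i) x).
Proof.
move=> pI pG a0; rewrite /expsum.
have up : uniq (codom p) by rewrite codomE map_inj_uniq// enum_uniq.
rewrite -(@fsbig_widen _ _ _ _ [set` codom p]).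
- by rewrite -fsbig_seq// codomE big_map big_enum.
- by move=> n /= /codomP[i ->].
- by move=> n [_ /= /negP np]; rewrite a0// mul0r.
Qed.

Lemma Lp_cubeE (R : realType) d (p : R) (f : d.-tuple (measurableTypeR R) -> R[i]) :
  (lebesgue_measureRd d).-integrable (unit_cube d)
    (EFin \o (fun x => normc (f x) `^ p)) ->
  Lp_cube p f =
    ((\int[lebesgue_measureRd d]_(x in unit_cube d) (normc (f x) `^ p)) `^ p^-1)%:E.
Proof.
move=> fi; rewrite /Lp_cube -poweR_EFin /Rintegral fineK//.
exact: (integrable_fin_num (@measurable_unit_cube R d) fi).
Qed.

Section counterexample.
Variables (R : realType) (d k : nat) (p : 'I_k.+1 -> 'rV[int]_d) (c : 'I_k.+1).
Hypothesis p_inj : injective p.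
Let u (i : 'I_k) := p (lift c i) - p c.

(* The common phase [e(p_c . x)] is factored out, so that the sign of the
   coefficient at [p c] becomes a global sign of the other terms. *)
Lemma normc_expsum_centered (Gamma : set 'rV[int]_d) (a : 'rV[int]_d -> R) (r : R) x :
  (forall i, Gamma (p i)) -> (forall n, n \notin codom p -> a n = 0) ->
  a (p c) ^+ 2 = 1 -> (forall i, a (p (lift c i)) = r) ->
  normc (expsum Gamma a x) =
  normc (1 + (a (p c) * r)%:C%C * \sum_i e2pi (dotZR (u i) x)).
Proof.
move=> pG a0 ac ar; rewrite (expsum_codom x p_inj pG a0) (bigD1_ord c)//=.
have -> : \sum_i (a (p (lift c i)))%:C%C * e2pi (dotZR (p (lift c i)) x) =
    e2pi (dotZR (p c) x) * (r%:C%C * \sum_i e2pi (dotZR (u i) x)).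
  rewrite mulrCA !mulr_sumr; apply: eq_bigr => i _.
  by rewrite ar -e2piD -dotZRD /u subrKC.
rewrite [X in X + _]mulrC -mulrDr normcM normc_e2pi mul1r.
set S := \sum_i _.
have -> : 1 + (a (p c) * r)%:C%C * S = (a (p c))%:C%C * ((a (p c))%:C%C + r%:C%C * S).
  by rewrite mulrDr -rmorphM/= -expr2 ac mulrA -rmorphM.
rewrite normcM normc_real.
have /eqP := ac; rewrite sqrf_eq1 => /orP[]/eqP ->; rewrite ?normrN normr1 mul1r//.
Qed.

End counterexample.

Theorem theorem2 (R : realType) (d : nat) (hd : (1 <= d)%N)
    (Gamma : set 'rV[int]_d) (hGamma : infinite_set Gamma) :
  infinite_set [set m : nat | (0 < m)%N /\
    exists a : 'rV[int]_d -> R,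
      finite_set (Gamma `&` [set n | a n != 0]) /\
      forall p : R, (2 * m)%:R < p -> p < (2 * m + 2)%:R ->
        (Lp_cube p (expsum Gamma (fun n => `|a n|%R)) <
         Lp_cube p (expsum Gamma a))%E].
Proof.
(* If only the m listed in [ms] worked, a circuit with P beyond their maximum would give a further
   one, m = P - 2. The offset 3 covers this shift and makes m positive. *)
move=> /finite_seqP[ms msE].
have [k [p [c [mu [p_inj pG [mu_rel mu_gen neg_pos odd_mu big_mu]]]]]] :=
  infinite_centered_circuit (\max_(i <- ms) i).+3 hGamma.
pose u (i : 'I_k) := p (lift c i) - p c.
have [m mE] : exists m, pos_weight mu = m.+2.
  by exists (pos_weight mu - 2)%N; lia.
suff : m \in ms.
  move=> m_in; have : (m <= \max_(i <- ms) i)%N by exact: (leq_bigmax_seq _ m_in).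
  by move: big_mu; rewrite mE; lia.
suff : [set` ms] m by [].
rewrite -msE /=; split; first by move: big_mu; rewrite mE; lia.
pose r : R := small_radius R m k (neg_weight mu).
have k_gt0 : (0 < k)%N by apply: (@pos_weight_dim _ mu); rewrite mE.
have r_gt0 : 0 < r by exact: small_radius_gt0.
(* Only the coefficient at p_c is negative, so absolute values turn -1 + r G into 1 + r G, up to the
   common phase. *)
pose a n : R := if n == p c then -1 else if n \in codom p then r else 0.
have a0 n : n \notin codom p -> a n = 0.
  move=> np; rewrite /a (negbTE np) ifN//; apply: contra np => /eqP ->.
  exact: codom_f.
have ac : a (p c) = -1 by rewrite /a eqxx.
have al i : a (p (lift c i)) = r.
  by rewrite /a codom_f ifN// (inj_eq p_inj) eq_sym neq_lift.
have na0 n : n \notin codom p -> `|a n| = 0 by move=> /a0 ->; rewrite normr0.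
exists a; split.
  apply: (@sub_finite_set _ _ [set` codom p]); last exact: finite_seq.
  by move=> n [_ /= an0]; apply: contraNT an0 => /a0 ->.
move=> q q_gt q_lt; pose s := q / 2.
have qs : q = 2 * s by rewrite /s; lra.
have ms' : m%:R < s by move: q_gt; rewrite natrM /s; lra.
have sm : s < m.+1%:R.
  by move: q_lt; rewrite natrD natrM /s -[m.+1%:R]natr1; lra.
have minus x : normc (expsum Gamma a x) =
    normc (1 + (- r)%:C%C * \sum_i e2pi (dotZR (u i) x)).
  by rewrite (normc_expsum_centered p_inj x pG a0 _ al) ac ?sqrrN ?expr1n ?mulN1r.
have plus x : normc (expsum Gamma (fun n => `|a n|) x) =
    normc (1 + r%:C%C * \sum_i e2pi (dotZR (u i) x)).
  rewrite (@normc_expsum_centered _ _ _ p c p_inj _ _ r x pG na0) ?ac ?normrN1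
    ?expr1n ?mul1r//.
  by move=> i; rewrite al gtr0_norm.
have gap := integral_gap mu_rel mu_gen mE neg_pos odd_mu ms' sm.
have ir (e : R) : `|e| = r -> (lebesgue_measureRd d).-integrable (unit_cube d)
    (EFin \o (fun x => normc (1 + e%:C%C * \sum_i e2pi (dotZR (u i) x)) `^ (2 * s))).
  exact: integrable_powR_exp_sum.
have plusq : (fun x => normc (expsum Gamma (fun n => `|a n|) x) `^ q) =
    fun x => normc (1 + r%:C%C * \sum_i e2pi (dotZR (u i) x)) `^ (2 * s).
  by apply/funext => x; rewrite plus qs.
have minusq : (fun x => normc (expsum Gamma a x) `^ q) =
    fun x => normc (1 + (- r)%:C%C * \sum_i e2pi (dotZR (u i) x)) `^ (2 * s).
  by apply/funext => x; rewrite minus qs.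
rewrite !Lp_cubeE ?plusq ?minusq; [|by apply: ir; rewrite ?normrN gtr0_norm..].
(* The power 1/q is strictly increasing on nonnegative reals, so the gap between the integrals
   passes to the norms. *)
rewrite lte_fin; apply: (gt0_ltr_powR _ _ _ gap).
- by rewrite invr_gt0 (le_lt_trans _ q_gt).
- by rewrite nnegrE Rintegral_ge0// => x _; exact: powR_ge0.
- by rewrite nnegrE Rintegral_ge0// => x _; exact: powR_ge0.
Qed.
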